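(* Let $k\in\mathbb{N}$, let $n\ge2$, and let $m_1,\dots,m_n\in\mathbb{N}$ be pairwise coprime. Then for any $\delta>0$ there exists $\varepsilon=\varepsilon(\delta,m_1,\dots,m_n,k)>0$ such that the following holds. For each $i\in\{1,\dots,n\}$ let $Z_i$ be a finite abelian group of torsion $m_i$, and let $f:\prod_{i=1}^nZ_i\to\mathbb{C}$ be a 1-bounded function satisfying $\|f\|_{U^{k+1}}>\delta$. Then $\|f\|_{\Box^n_1}>\varepsilon$.
   Context: An abelian group $Z$ has torsion $m$ if $mx=0$ for all $x\in Z$. A function is 1-bounded if its modulus is at most 1; $\mathbb{E}$ denotes the average. On a finite abelian group $Z$, $\|f\|_{U^{k+1}}^{2^{k+1}}=\mathbb{E}_{x,h_1,\dots,h_{k+1}\in Z}\prod_{v\in\{0,1\}^{k+1}}\mathcal{C}^{|v|}f(x+\sum_i v_ih_i)$, with $\mathcal{C}$ complex conjugation and $|v|=\sum_iv_i$; here it is taken on the group $\prod_{i=1}^n Z_i$. For finite sets $A_1,\dots,A_n$ and an integer $d\in[1,n-1]$, the $(n,d)$-cut norm of $f:\prod_{i=1}^nA_i\to\mathbb{C}$ is $$\|f\|_{\Box^n_d}:=\max_{u_B:\prod_{i\in B}A_i\to\mathbb{D},\ \forall B\in\binom{[n]}{d}}\Big|\mathbb{E}_{\underline a\in\prod_{i=1}^nA_i}f(\underline a)\prod_{B\in\binom{[n]}{d}}\overline{u_B(\underline a_B)}\Big|,$$ where $\mathbb{D}$ is the closed unit disc in $\mathbb{C}$, $\binom{[n]}{d}$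 is the set of $d$-element subsets of $[n]=\{1,\dots,n\}$, and $\underline a_B$ is the projection of $\underline a$ to the coordinates indexed by $B$. *)

(* Defs.v *)
From HB Require Import structures.
From mathcomp Require Import all_boot all_order all_algebra.
From mathcomp Require Import complex.
From mathcomp Require Import all_classical all_reals all_analysis.

Set Implicit Arguments.
Unset Strict Implicit.
Unset Printing Implicit Defensive.

Import Order.TTheory GRing.Theory Num.Theory.

Local Open Scope classical_set_scope.
Local Open Scope ring_scope.

(* The library equips only non-dependent [{ffun I -> V}] with a group law;   *)
(* the direct product of a family [Z] is [{dffun forall i, Z i}].            *)
Section DirectProduct.
Variables (I : finType) (Z : I -> finZmodType).
Implicit Types x y z : {dffun forall i : I, Z i}.

Definition dffun_zero : {dffun forall i : I, Z i} := [ffun i => 0].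
Definition dffun_opp x : {dffun forall i : I, Z i} := [ffun i => - x i].
Definition dffun_add x y : {dffun forall i : I, Z i} := [ffun i => x i + y i].

Fact dffun_addA : associative dffun_add.
Proof. by move=> x y z; apply/ffunP => i; rewrite !ffunE addrA. Qed.
Fact dffun_addC : commutative dffun_add.
Proof. by move=> x y; apply/ffunP => i; rewrite !ffunE addrC. Qed.
Fact dffun_add0 : left_id dffun_zero dffun_add.
Proof. by move=> x; apply/ffunP => i; rewrite !ffunE add0r. Qed.
Fact dffun_addN : left_inverse dffun_zero dffun_opp dffun_add.
Proof. by move=> x; apply/ffunP => i; rewrite !ffunE addNr. Qed.

HB.instance Definition _ :=
  GRing.isZmodule.Build {dffun forall i : I, Z i}
    dffun_addA dffun_addC dffun_add0 dffun_addN.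

End DirectProduct.

Definition has_torsion (Z : zmodType) (m : nat) : Prop :=
  forall x : Z, x *+ m = 0.

Section Norms.
Variable R : realType.
Local Notation C := R[i].

Definition modulus (z : C) : R := ComplexField.Normc.normc z.

Definition one_bounded (T : Type) (f : T -> C) : Prop :=
  forall x, modulus (f x) <= 1.

Definition avg (T : finType) (F : T -> C) : C :=
  (\sum_(x : T) F x) / #|T|%:R.

(* The 2^s-th power of the U^s norm; a vertex v of the cube {0,1}^s is a     *)
(* boolean vector, coerced coordinatewise to {0,1}.                          *)
Definition gowers_avg (Z : finZmodType) (s : nat) (f : Z -> C) : C :=
  avg (fun xh : Z * {ffun 'I_s -> Z} =>
    \prod_(v : {ffun 'I_s -> bool})
      iter (\sum_(i < s) v i)%N Num.conj
        (f (xh.1 + \sum_(i < s) xh.2 i *+ v i))).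

(* For s >= 1, [gowers_avg s f] is a nonnegative real number, so that taking *)
(* its real part only changes the type.                                      *)
Definition gowers_norm (Z : finZmodType) (s : nat) (f : Z -> C) : R :=
  complex.Re (gowers_avg s f) `^ ((2 ^ s)%N%:R)^-1.

Section CutNorm.
Variables (n : nat) (A : 'I_n -> finType).

Definition subprod (B : {set 'I_n}) : finType :=
  {dffun forall j : {i : 'I_n | i \in B}, A (val j)}.

Definition coord_proj (B : {set 'I_n}) (a : {dffun forall i : 'I_n, A i}) :
  subprod B := [ffun j => a (val j)].

(* The supremum below is a maximum, by compactness of the closed unit disc.  *)
(* Only the u B with #|B| = d matter.                                        *)
Definition cut_norm (d : nat) (f : {dffun forall i : 'I_n, A i} -> C) : R :=
  sup [set r : R | exists u : forall B : {set 'I_n}, subprod B -> C,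
    (forall B : {set 'I_n}, #|B| = d -> one_bounded (u B)) /\
    r = modulus (avg (fun a : {dffun forall i : 'I_n, A i} =>
          f a * \prod_(B : {set 'I_n} | #|B| == d) (u B (coord_proj B a))^*))].

End CutNorm.
End Norms.

(* Main.v *)
(* A power of the U^s norm of [f] is a pairing of [f] with a dual function, dual    *)

(* The reason behind coprimality: a map between groups of coprime torsion that is approximately
   additive must be nearly constant. [graph_energy_popular] makes this quantitative, and
   [structured_popular] applies it to the characters that [character_correlation] produces.
   [product_detects_step] runs the energy decrement, with bounds that depend on the torsions but not
   on the groups. To go from two groups to n, [product_detects_slice] trades the pairing on [X * Y]
   for one on [Y] alone, between an average of [g] over [X] and a slice of the dual function. A
   slice is dual of the same order ([isdual_slice]), so [dual_correlation] can repeat this.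
   [gowers_avg_dual] and [cut_norm_ge] translate between dual functions, products and the two
   norms. *)
(* functions being generated from constants by [F x = E_h f (x + h) * D_h x].  The  *)
(* claim, for two groups X and Y of coprime torsion, is that a function pairing     *)
(* with a dual function of order s correlates with some [u x * v y]; induct on s.   *)
(* Let [g] pair with a dual function F of order s + 1.                              *)
(* - Shifting only the Y variable and applying the claim for s, Fourier analysis on *)
(*   Y shows that [g] correlates with some [b y * a x * xi_x y], where each xi_x is *)
(*   a character of Y.                                                              *)
(* - Shifting only the X variable instead, such a function pairs with F only if     *)
(*   the graph of [x |-> xi_x] has large additive energy.  By Balog-Szemeredi-      *)
(*   Gowers and Plunnecke a large piece of the graph has small N-fold sums, where   *)
(*   multiplication by N kills X and fixes the dual of Y; this forces xi to be      *)
(*   constant on a positive proportion of X.                                        *)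
(* So either [g] correlates with [b y * a x * xi_x y] on the x for which xi_x is    *)
(* popular, hence with a product, or that function restricted to the other x can    *)
(* be subtracted from [g] without noticeably affecting its pairing with F or its    *)
(* correlation with products; the energy of [g] drops, so this happens a bounded    *)
(* number of times.  Splitting off one factor at a time gives n groups.             *)
Require Import Defs.
From HB Require Import structures.
From mathcomp Require Import all_boot all_order all_algebra.
From mathcomp Require Import fingroup cyclic separable algC cyclotomic.
From mathcomp Require Import classfun character.
From mathcomp Require Import complex ring lra zify.
From mathcomp Require Import all_classical all_reals all_analysis.
From mathcomp Require Import fintype finset.

Set Implicit Arguments.
Unset Strict Implicit.
Unset Printing Implicit Defensive.

Import Order.TTheory GRing.Theory Num.Theory.

Local Open Scope ring_scope.

Local Notation "b %:B" := ((b : bool)%:R) (at level 2, format "b %:B").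

(** * Averages *)

HB.instance Definition _ (X Y : finZmodType) := GRing.Zmodule.on (X * Y)%type.
HB.instance Definition _ (T : finType) (Z : finZmodType) :=
  GRing.Zmodule.on {ffun T -> Z}.

Section Averages.
Variable K : numFieldType.

(** Over an empty type the value is 0, as division by 0 gives 0; hence a positive lower bound on an
    average always supplies a point. Over [R[i]] this is convertible to [avg]. *)
Definition Ex (T : finType) (F : T -> K) : K := (\sum_x F x) / #|T|%:R.

End Averages.

Notation "\avg_ x F" := (Ex (fun x => F))
  (at level 36, F at level 36, x at level 0, format "\avg_ x  F") : ring_scope.

Section AverageTheory.
Variable K : numFieldType.
Implicit Types T U : finType.

Lemma eq_Ex T (F G : T -> K) : F =1 G -> \avg_x F x = \avg_x G x.
Proof. by move=> eqFG; rewrite /Ex (eq_bigr _ (fun x _ => eqFG x)). Qed.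

Lemma ExD T (F G : T -> K) : \avg_x (F x + G x) = \avg_x F x + \avg_x G x.
Proof. by rewrite /Ex big_split mulrDl. Qed.

Lemma ExN T (F : T -> K) : \avg_x (- F x) = - \avg_x F x.
Proof. by rewrite /Ex sumrN mulNr. Qed.

Lemma ExB T (F G : T -> K) : \avg_x (F x - G x) = \avg_x F x - \avg_x G x.
Proof. by rewrite ExD ExN. Qed.

Lemma ExZl T c (F : T -> K) : \avg_x (c * F x) = c * \avg_x F x.
Proof. by rewrite /Ex -mulr_sumr mulrA. Qed.

Lemma ExZr T c (F : T -> K) : \avg_x (F x * c) = (\avg_x F x) * c.
Proof. by rewrite /Ex -mulr_suml mulrAC. Qed.

Lemma Ex_sum T (I : Type) (r : seq I) (P : pred I) (F : I -> T -> K) :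
  \avg_x (\sum_(i <- r | P i) F i x) = \sum_(i <- r | P i) \avg_x F i x.
Proof. by rewrite /Ex exchange_big /= mulr_suml. Qed.

Lemma Ex_cst T (x0 : T) (c : K) : Ex (fun _ : T => c) = c.
Proof.
rewrite /Ex sumr_const -[c *+ _]mulr_natr mulfK // pnatr_eq0 -lt0n.
by apply/card_gt0P; exists x0.
Qed.

Lemma Ex0 T : Ex (fun _ : T => 0 : K) = 0.
Proof. by rewrite /Ex big1 ?mul0r. Qed.

Lemma Ex_swap T U (F : T -> U -> K) :
  \avg_x \avg_y F x y = \avg_y \avg_x F x y.
Proof.
rewrite /Ex -!mulr_suml exchange_big /= -!mulrA; congr (_ * _).
exact: mulrC.
Qed.

Lemma Ex_pair T U (F : T -> U -> K) :
  \avg_p F p.1 p.2 = \avg_x \avg_y F x y.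
Proof.
by rewrite /Ex -mulr_suml pair_bigA card_prod natrM invfM /= -mulrA [_^-1 * _]mulrC.
Qed.

Lemma Ex_mul T U (F : T -> K) (G : U -> K) :
  (\avg_x F x) * (\avg_y G y) = \avg_x \avg_y (F x * G y).
Proof.
by rewrite -ExZr; apply: eq_Ex => x; rewrite ExZl.
Qed.

Lemma Ex_bij T U (h : T -> U) (F : U -> K) : bijective h ->
  \avg_x F (h x) = \avg_y F y.
Proof.
move=> bijh; rewrite /Ex (bij_eq_card bijh); congr (_ / _).
by rewrite [RHS](reindex h) //; apply: onW_bij.
Qed.

Lemma Ex_shift (G : finZmodType) (h : G) (F : G -> K) :
  \avg_x F (x + h) = \avg_x F x.
Proof. by apply: Ex_bij; exists (fun x => x - h) => x; rewrite ?addrK ?subrK. Qed.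

Lemma Ex_shiftl (G : finZmodType) (h : G) (F : G -> K) :
  \avg_x F (h + x) = \avg_x F x.
Proof. by rewrite -[RHS](Ex_shift h); apply: eq_Ex => x; rewrite addrC. Qed.

Lemma le_Ex T (F G : T -> K) : (forall x, F x <= G x) -> \avg_x F x <= \avg_x G x.
Proof. by move=> leFG; rewrite /Ex ler_wpM2r ?invr_ge0 ?ler0n // ler_sum. Qed.

Lemma Ex_ge0 T (F : T -> K) : (forall x, 0 <= F x) -> 0 <= \avg_x F x.
Proof. by move=> F0; rewrite -(Ex0 T); apply: le_Ex. Qed.

Lemma Ex_le T (F : T -> K) (c : K) : 0 <= c -> (forall x, F x <= c) -> \avg_x F x <= c.
Proof.
move=> c0 leF; have [x0 _|T0] := pickP T; last first.
  by rewrite /Ex (big_pred0 _ _ _ _ T0) mul0r.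
by rewrite -[leRHS](Ex_cst x0); apply: le_Ex.
Qed.

End AverageTheory.

Section RealAverages.
Variable R : realFieldType.
Implicit Types T U : finType.

Lemma Ex_exists T (F : T -> R) c : 0 < c -> c <= \avg_x F x -> exists x, c <= F x.
Proof.
move=> c0 cF; have [x cx|noF] := pickP (fun x => c <= F x); first by exists x.
have [x0 _|T0] := pickP T; last first.
  by move: cF; rewrite /Ex (big_pred0 _ _ _ _ T0) mul0r leNgt c0.
suff : \avg_x F x < c by rewrite ltNge cF.
rewrite /Ex ltr_pdivrMr; last by rewrite ltr0n; apply/card_gt0P; exists x0.
rewrite mulr_natr -sumr_const; apply: ltr_sum => [|x _]; last by rewrite ltNge noF.
by apply/hasP; exists x0; rewrite ?mem_index_enum.
Qed.

Lemma Ex_CauchySchwarz T (F G : T -> R) :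
  (\avg_x (F x * G x)) ^+ 2 <= (\avg_x (F x ^+ 2)) * \avg_x (G x ^+ 2).
Proof.
have: 0 <= \avg_x \avg_y ((F x * G y - F y * G x) ^+ 2).
  by apply: Ex_ge0 => x; apply: Ex_ge0 => y; apply: sqr_ge0.
have -> : \avg_x \avg_y ((F x * G y - F y * G x) ^+ 2) =
   (\avg_x (F x ^+ 2)) * (\avg_x (G x ^+ 2)) *+ 2 - (\avg_x (F x * G x)) ^+ 2 *+ 2.
  rewrite [in RHS]mulr2n {2}[(\avg_x (F x ^+ 2)) * _]mulrC.
  rewrite (expr2 (\avg_x _)) !Ex_mul -mulr_natl -ExZl -ExD -ExB.
  apply: eq_Ex => x; rewrite -ExZl -ExD -ExB.
  by apply: eq_Ex => y; ring.
by rewrite subr_ge0 lerMn2r /=.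
Qed.

Lemma Ex_sqr T (F : T -> R) : (\avg_x F x) ^+ 2 <= \avg_x (F x ^+ 2).
Proof.
have [x0 _|T0] := pickP T; last by rewrite /Ex !(big_pred0 _ _ _ _ T0) mul0r expr0n.
have := Ex_CauchySchwarz F (fun _ => 1); rewrite (eq_Ex (fun x => mulr1 (F x))).
by rewrite [X in _ <= _ * X](eq_Ex (fun _ => expr1n _ _)) (Ex_cst x0) mulr1.
Qed.

End RealAverages.

Section ComplexAverages.
Variable R : rcfType.
Local Notation C := R[i].
Implicit Types (T U : finType) (z w : C).

Definition mo z : R := ComplexField.Normc.normc z.

Lemma moE z : (mo z)%:C%C = `|z|. Proof. by []. Qed.

Lemma mo_ge0 z : 0 <= mo z. Proof. by rewrite -ler0c moE. Qed.
Lemma mo0 : mo 0 = 0. Proof. exact: ComplexField.Normc.normc0. Qed.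
Lemma mo1 : mo 1 = 1. Proof. exact: ComplexField.Normc.normc1. Qed.
Lemma moM z w : mo (z * w) = mo z * mo w. Proof. exact: ComplexField.Normc.normcM. Qed.
Lemma moN z : mo (- z) = mo z. Proof. by apply: complexI; rewrite !moE normrN. Qed.
Lemma moJ z : mo (z^*) = mo z. Proof. by apply: complexI; rewrite !moE norm_conjC. Qed.
Lemma moD z w : mo (z + w) <= mo z + mo w.
Proof. by rewrite -lecR rmorphD !moE ler_normD. Qed.
Lemma moX z n : mo (z ^+ n) = mo z ^+ n.
Proof. by elim: n => [|n IHn]; rewrite ?expr0 ?mo1 // !exprS moM IHn. Qed.
Lemma mo_sum I (r : seq I) (P : pred I) (F : I -> C) :
  mo (\sum_(i <- r | P i) F i) <= \sum_(i <- r | P i) mo (F i).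
Proof.
elim/big_rec2: _ => [|i x y _ le_xy]; first by rewrite mo0.
by apply: le_trans (moD _ _) _; rewrite lerD2l.
Qed.
Lemma mo_real (x : R) : 0 <= x -> mo x%:C%C = x.
Proof. by move=> x0; apply: complexI; rewrite moE ger0_norm // ler0c. Qed.

Lemma sqr_mo z : (mo z ^+ 2)%:C%C = z * z^*.
Proof. by rewrite rmorphXn /= moE normCK. Qed.

Lemma real_complex_avg T (F : T -> R) : (\avg_x F x)%:C%C = \avg_x (F x)%:C%C.
Proof. by rewrite /Ex rmorphM /= fmorphV rmorph_nat rmorph_sum. Qed.

Lemma conj_avg T (F : T -> C) : (\avg_x F x)^* = \avg_x (F x)^*.
Proof. by rewrite /Ex rmorphM /= fmorphV rmorph_nat rmorph_sum. Qed.

Lemma mo_avg T (F : T -> C) : mo (\avg_x F x) <= \avg_x mo (F x).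
Proof.
rewrite -lecR real_complex_avg moE /Ex normrM normfV normr_nat.
by rewrite ler_wpM2r ?invr_ge0 ?ler0n // ler_norm_sum.
Qed.

Lemma sqr_mo_avg T (F : T -> C) : mo (\avg_x F x) ^+ 2 <= \avg_x (mo (F x) ^+ 2).
Proof.
apply: le_trans (Ex_sqr _); rewrite lerXn2r ?nnegrE ?mo_ge0 ?mo_avg //.
by apply: Ex_ge0 => x; apply: mo_ge0.
Qed.

Lemma mo_CauchySchwarz T (F G : T -> C) :
  mo (\avg_x (F x * G x)) ^+ 2 <= (\avg_x (mo (F x) ^+ 2)) * \avg_x (mo (G x) ^+ 2).
Proof.
apply: le_trans (Ex_CauchySchwarz _ _).
rewrite lerXn2r ?nnegrE ?mo_ge0 //; first by apply: Ex_ge0 => x; rewrite mulr_ge0 ?mo_ge0.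
by rewrite -(eq_Ex (fun x => moM (F x) (G x))) mo_avg.
Qed.

Lemma mo_avg_exists T (F : T -> C) c :
  0 < c -> c <= mo (\avg_x F x) -> exists x, c <= mo (F x).
Proof. by move=> c0 cF; apply: Ex_exists => //; apply: le_trans cF (mo_avg _). Qed.

Lemma sqr_moD z w : mo (z + w) ^+ 2 <= 2 * mo z ^+ 2 + 2 * mo w ^+ 2.
Proof.
apply: (@le_trans _ _ ((mo z + mo w) ^+ 2)).
  by rewrite lerXn2r ?nnegrE ?addr_ge0 ?mo_ge0 ?moD.
by have := sqr_ge0 (mo z - mo w); nra.
Qed.

Lemma phase z : exists2 c : C, mo c <= 1 & c * z = (mo z)%:C%C.
Proof.
have [->|nz] := eqVneq z 0; first by exists 0; rewrite ?mo0 ?mul0r ?ler01.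
have mz : mo z != 0 by apply: contraNneq nz => /ComplexField.Normc.eq0_normc ->.
exists (z^* * (mo z)^-1%:C%C).
  by rewrite moM moJ mo_real ?invr_ge0 ?mo_ge0 // mulfV.
by rewrite mulrAC [_^* * _]mulrC -sqr_mo -rmorphM /= expr2 mulfK.
Qed.

End ComplexAverages.

(** * Additive combinatorics *)

Section Sumsets.
Variable G : finZmodType.
Implicit Types A B C X Q : {set G}.

Definition sumset A B : {set G} := [set x + y | x in A, y in B].

Lemma mem_sumset A B x y : x \in A -> y \in B -> x + y \in sumset A B.
Proof. exact: imset2_f. Qed.

Lemma sumset0 A : sumset A set0 = set0.
Proof. by apply/setP=> z; rewrite inE; apply/negP=> /imset2P[x y _]; rewrite inE. Qed.

Lemma sumsetA A B C : sumset A (sumset B C) = sumset (sumset A B) C.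
Proof.
apply/setP=> z; apply/imset2P/imset2P => [[x _ xA /imset2P[y w yB wC ->] ->]|].
  by exists (x + y) w; rewrite ?mem_sumset ?addrA.
case=> _ w /imset2P[x y xA yB ->] wC ->.
by exists x (y + w); rewrite ?mem_sumset ?addrA.
Qed.

Lemma sumset_set1 A c : sumset A [set c] = +%R^~ c @: A.
Proof.
apply/setP=> z; apply/imset2P/imsetP => [[x _ xA /set1P-> ->]|[x xA ->]].
  by exists x.
by exists x c; rewrite ?set11.
Qed.

Lemma card_sumset1 A c : #|sumset A [set c]| = #|A|.
Proof. by rewrite sumset_set1 card_imset //; apply: addIr. Qed.

Lemma sumsetU A B C : sumset A (B :|: C) = sumset A B :|: sumset A C.
Proof.
apply/setP=> z; rewrite inE; apply/imset2P/orP => [[x y xA]|].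
  by rewrite inE => /orP[yB|yC] ->; [left|right]; apply: mem_sumset.
by case=> /imset2P[x y xA yB ->]; exists x y; rewrite // inE yB ?orbT.
Qed.

Lemma sumsetSl A A' B : A \subset A' -> sumset A B \subset sumset A' B.
Proof. by move=> sAA'; apply: imset2Sl. Qed.

(** The hypothesis says that [X] minimises the ratio |Z + Q| / |Z| over its subsets. Let [Z] consist
    of the z in [X] for which z + Q + c is already covered. Adding c to [C'] enlarges X + Q + C' by
    at most |X + Q| - |Z + Q| and X + C' by at least |X| - |Z|; minimality at [Z] compares the
    two. *)
Lemma petridis X Q :
    (forall Z : {set G}, Z \subset X -> (#|sumset X Q| * #|Z| <= #|sumset Z Q| * #|X|)%N) ->
  forall C, (#|sumset (sumset X Q) C| * #|X| <= #|sumset X Q| * #|sumset X C|)%N.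
Proof.
move=> minX C; elim: {C}#|C| {-2}C (erefl #|C|) => [|n IHn] C.
  by move/eqP; rewrite cards_eq0 => /eqP->; rewrite !sumset0 cards0.
move=> cardC; have [c cC] : exists c, c \in C by apply/card_gt0P; rewrite cardC.
pose C' := C :\ c; have defC : C = C' :|: [set c] by rewrite setUC setD1K.
have /IHn{IHn} : #|C'| = n by move: cardC; rewrite (cardsD1 c) cC => -[].
rewrite defC !sumsetU; set XQC := sumset _ C'; set XC := sumset X C' => IH.
pose Z := [set z in X | sumset (sumset [set z] Q) [set c] \subset XQC].
have sZX : Z \subset X by apply/subsetP=> z; rewrite inE => /andP[].
have sZ : sumset (sumset Z Q) [set c] \subset XQC.
  apply/subsetP=> w; rewrite sumset_set1 => /imsetP[_ /imset2P[z q + qQ ->] ->].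
  rewrite inE => /andP[_ /subsetP]; apply; rewrite mem_sumset ?set11 //.
  by rewrite mem_sumset ?set11.
have leXQ : (#|XQC :|: sumset (sumset X Q) [set c]| + #|sumset Z Q|
             <= #|XQC| + #|sumset X Q|)%N.
  rewrite -(card_sumset1 (sumset X Q) c) -(cardsUI XQC) leq_add2l.
  rewrite -(card_sumset1 (sumset Z Q) c) subset_leq_card // subsetI sZ.
  by rewrite sumsetSl ?sumsetSl.
have leX : (#|XC| + #|X| <= #|XC :|: sumset X [set c]| + #|Z|)%N.
  rewrite -(card_sumset1 X c) -(cardsUI XC) leq_add2l sumset_set1.
  apply: (@leq_trans #|[set x in X | (x + c)%R \in XC]|).
    rewrite -(card_imset [set x in X | _] (addIr c)) subset_leq_card //.
    apply/subsetP=> w /setIP[wC /imsetP[x xX defw]]; rewrite defw in wC *.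
    by apply: imset_f; rewrite inE xX.
  apply/subset_leq_card/subsetP=> x; rewrite !inE => /andP[xX xC]; rewrite xX /=.
  apply/subsetP=> w; rewrite sumset_set1 => /imsetP[_ /imset2P[_ q /set1P-> qQ ->] ->].
  case/imset2P: xC => x' c' x'X c'C' def; rewrite addrAC def addrAC.
  by rewrite !mem_sumset.
have := minX Z sZX; move: leXQ leX IH.
move: #|_| #|_| #|_| #|_| #|_| #|_| #|_| => a b d u v w z; nia.
Qed.

Fixpoint multiple_sum n A : {set G} :=
  if n is n'.+1 then sumset A (multiple_sum n' A) else [set 0].

Lemma mem_multiple_sum n A x : x \in A -> x *+ n \in multiple_sum n A.
Proof.
by move=> xA; elim: n => [|n IHn] /=; rewrite ?set11 // mulrS mem_sumset.
Qed.

(** A nonempty [X] in [A] of least ratio |X + Q| / |X| satisfies the hypothesis of [petridis].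
    Taking for [C] the multiple sums of [Q], each further summand [Q] costs a factor of at most
    [K]. *)
Lemma plunnecke (R : realFieldType) (A Q : {set G}) (K : R) : A != set0 ->
    #|sumset A Q|%:R <= K * #|A|%:R ->
  exists X, [/\ X \subset A, X != set0 &
    forall n, #|sumset X (multiple_sum n Q)|%:R <= K ^+ n * #|X|%:R].
Proof.
move=> A0 leK.
pose ok X := (X \subset A) && (X != set0).
pose F X : R := #|sumset X Q|%:R / #|X|%:R.
have okA : ok A by rewrite /ok subxx.
have [X /andP[sXA X0] minX] := (Order.TotalTheory.arg_minP F okA).
have cardX0 Y : Y != set0 -> 0 < #|Y|%:R :> R by rewrite ltr0n card_gt0.
exists X; split=> //; elim=> [|n IHn] /=.
  by rewrite card_sumset1 expr0 mul1r.
have FXK : F X <= K.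
  by apply: le_trans (minX A okA) _; rewrite ler_pdivrMr ?cardX0.
have: (#|sumset (sumset X Q) (multiple_sum n Q)| * #|X|
        <= #|sumset X Q| * #|sumset X (multiple_sum n Q)|)%N.
  apply: petridis => Z sZX; have [->|Z0] := eqVneq Z set0; first by rewrite cards0 muln0.
  have := minX Z; rewrite /F /ok (subset_trans sZX sXA) Z0 => /(_ isT).
  by rewrite ler_pdivrMr ?cardX0 // mulrAC ler_pdivlMr ?cardX0 // -!natrM ler_nat.
rewrite -(ler_nat R) !natrM -ler_pdivlMr ?cardX0 // sumsetA => /le_trans leX.
apply: leX; rewrite mulrAC exprS -[K * _ * _]mulrA ler_pM ?divr_ge0 ?ler0n //.
Qed.

End Sumsets.

Section Graph.
Variable R : realFieldType.
Implicit Types T : finType.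

Lemma indicM (a b : bool) : (a && b)%:B = a%:B * b%:B :> R.
Proof. by rewrite -natrM mulnb. Qed.

Lemma indic_ge0 (b : bool) : 0 <= b%:B :> R. Proof. exact: ler0n. Qed.
Lemma indic_le1 (b : bool) : b%:B <= 1 :> R. Proof. by rewrite lern1 leq_b1. Qed.

Lemma Ex_indic T (A : {set T}) : \avg_x (x \in A)%:B = #|A|%:R / #|T|%:R :> R.
Proof. by rewrite /Ex -natr_sum -big_mkcond sum1_card. Qed.

Lemma Ex_indic_le1 T (P : pred T) : \avg_x (P x)%:B <= 1 :> R.
Proof. by apply: Ex_le => // x; apply: indic_le1. Qed.

(* Balog-Szemeredi-Gowers: [A] is most of the neighbourhood of a well chosen *)
(* vertex, in which few pairs have few common neighbours.                    *)
Lemma dense_graph_paths T (e : rel T) (alpha : R) :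
    0 < alpha -> symmetric e -> alpha <= \avg_x \avg_y (e x y)%:B ->
  exists A B : {set T},
    [/\ alpha ^+ 2 / 16 <= \avg_x (x \in A)%:B,
        alpha / 4 <= \avg_x (x \in B)%:B &
        forall a b, a \in A -> b \in B ->
          (alpha / 8) ^+ 6 <= \avg_u \avg_v ([&& e a u, e u v & e v b])%:B].
Proof.
move=> a0 sym_e dense; pose deg x : R := \avg_y (e x y)%:B.
have a1 : alpha <= 1.
  by apply: le_trans dense _; apply: Ex_le => // x; apply: Ex_indic_le1.
pose A1 := [set x | alpha / 2 <= deg x].
have deg_ge0 x : 0 <= deg x by apply: Ex_ge0 => y; apply: indic_ge0.
pose N b := [set a in A1 | e a b].
pose nu b : R := \avg_a (a \in N b)%:B.
have nu_ge0 b : 0 <= nu b by apply: Ex_ge0 => y; apply: indic_ge0.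
have nu_le1 b : nu b <= 1 by apply: Ex_indic_le1.
have Enu : alpha / 2 <= \avg_b nu b.
  rewrite /nu Ex_swap.
  have -> : alpha / 2 = alpha - alpha / 2 by field.
  apply: (@le_trans _ _ (\avg_x deg x - alpha / 2)); first by rewrite lerD2r.
  have [x0 _|T0] := pickP T; last first.
    by move: dense; rewrite /Ex (big_pred0 _ _ _ _ T0) mul0r leNgt a0.
  rewrite -(Ex_cst x0 (alpha / 2)) -ExB; apply: le_Ex => x.
  case A1x: (x \in A1); last first.
    apply: (@le_trans _ _ 0); last by apply: Ex_ge0 => y; apply: indic_ge0.
    by rewrite subr_le0 ltW // ltNge; move: A1x; rewrite inE => ->.
  rewrite lerBlDr (@le_trans _ _ (\avg_y (x \in N y)%:B)) //; last first.
    by rewrite lerDl divr_ge0 // ltW.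
  by apply: le_Ex => y; rewrite inE A1x.
pose codeg a a' : R := \avg_b (e a b && e a' b)%:B.
pose eps := alpha ^+ 3 / 128.
pose bad a a' := codeg a a' < eps.
pose badN b : R := \avg_a \avg_a' ([&& a \in N b, a' \in N b & bad a a'])%:B.
have eps0 : 0 < eps by rewrite divr_gt0 ?exprn_gt0.
have EbadN : \avg_b badN b <= eps.
  rewrite /badN Ex_swap; apply: Ex_le => [|a]; first exact: ltW.
  rewrite Ex_swap; apply: Ex_le => [|a']; first exact: ltW.
  case b_aa': (bad a a'); last first.
    rewrite (@eq_Ex _ _ _ (fun=> 0)) ?Ex0 ?ltW // => b; by rewrite !andbF.
  apply: (@le_trans _ _ (codeg a a')); last exact: ltW.
  rewrite /codeg; apply: le_Ex => b; rewrite ler_nat !inE.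
  by case: (e a b); case: (e a' b); rewrite ?andbF ?leq_b1.
(* First moment: [nu ^+ 2] has average at least [alpha ^+ 2 / 4], while [badN] has average at most
   [eps], and [16 / alpha * eps] is [alpha ^+ 2 / 8]. The chosen [b] has a large neighbourhood with
   few bad pairs in it. *)
have [b hb] : exists b, alpha ^+ 2 / 8 <= nu b ^+ 2 - 16 / alpha * badN b.
  apply: Ex_exists; first by rewrite divr_gt0 ?exprn_gt0.
  rewrite ExB ExZl; have := Ex_sqr nu.
  have : 16 / alpha * (\avg_b badN b) <= alpha ^+ 2 / 8.
    have -> : alpha ^+ 2 / 8 = 16 / alpha * eps by rewrite /eps; field; rewrite gt_eqF.
    by rewrite ler_wpM2l // divr_ge0 // ltW.
  have : (alpha / 2) ^+ 2 <= (\avg_b nu b) ^+ 2.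
    rewrite lerXn2r ?nnegrE //; first by rewrite divr_ge0 // ltW.
    by apply: Ex_ge0.
  lra.
have badN_ge0 : 0 <= badN b by apply: Ex_ge0 => x; apply: Ex_ge0 => y; apply: indic_ge0.
have ibad : 0 <= 16 / alpha * badN b by rewrite mulr_ge0 // divr_ge0 // ltW.
have nub0 : alpha ^+ 2 / 8 <= nu b.
  by have := nu_ge0 b; have := nu_le1 b; nra.
have nub_gt0 : 0 < nu b by apply: lt_le_trans nub0; rewrite divr_gt0 ?exprn_gt0.
have hbad : badN b <= alpha / 16 * nu b ^+ 2.
  have -> : badN b = alpha / 16 * (16 / alpha * badN b) by field; rewrite gt_eqF.
  rewrite ler_pM2l ?divr_gt0 //.
  by have : 0 <= alpha ^+ 2 / 8; [rewrite divr_ge0 ?sqr_ge0 | lra].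
pose beta a : R := \avg_a' ((a' \in N b) && bad a a')%:B.
have beta_ge0 a : 0 <= beta a by apply: Ex_ge0 => y; apply: indic_ge0.
(* [A] keeps the vertices of [N b] that lie in few bad pairs; [B] keeps those with many neighbours
   in [N b], and is large because every vertex of [N b] has degree at least [alpha / 2]. *)
pose A := [set a in N b | beta a <= alpha / 8 * nu b].
pose B := [set y | alpha * nu b / 4 <= \avg_a' ((a' \in N b) && e a' y)%:B].
exists A, B; split.
- suff : nu b / 2 <= \avg_x (x \in A)%:B by lra.
  have : (\avg_a (a \in N b)%:B - \avg_x (x \in A)%:B) * (alpha / 8 * nu b) <= badN b.
    rewrite -ExB -ExZr; apply: le_Ex => a.
    rewrite [leRHS](eq_Ex (fun a' => indicM _ _)) ExZl [a \in A]inE.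
    case: (a \in N b) => /=; last by rewrite subrr !mul0r.
    rewrite mul1r; case: (leP (beta a)) => [_|/ltW ba] /=; first by rewrite subrr mul0r; apply: beta_ge0.
    by rewrite subr0 mul1r.
  rewrite -/(nu b) => h.
  have : (nu b - \avg_x (x \in A)%:B) * (alpha / 8 * nu b) <= nu b / 2 * (alpha / 8 * nu b).
    apply: le_trans h _; apply: le_trans hbad _; rewrite le_eqVlt.
    by apply/orP; left; apply/eqP; field.
  rewrite ler_pM2r; first lra.
  by apply: mulr_gt0 => //; apply: divr_gt0.
- have : alpha / 2 * nu b <= \avg_y \avg_a' ((a' \in N b) && e a' y)%:B.
    rewrite Ex_swap -ExZl; apply: le_Ex => a'.
    rewrite [leRHS](eq_Ex (fun y => indicM _ _)) ExZl.
    case: (boolP (a' \in N b)); rewrite ?mulr0 ?mul0r ?mulr1 ?mul1r //.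
    by rewrite inE => /andP[]; rewrite inE.
  have : \avg_y \avg_a' ((a' \in N b) && e a' y)%:B
     <= \avg_y ((y \in B)%:B * nu b + alpha * nu b / 4).
    apply: le_Ex => y; rewrite [y \in B]inE; case: (leP (alpha * nu b / 4)) => [_|/ltW].
      rewrite mul1r (@le_trans _ _ (nu b)) //; last first.
        by rewrite lerDl; apply: divr_ge0 => //; apply: mulr_ge0 => //; apply: ltW.
      by rewrite /nu; apply: le_Ex => a'; rewrite ler_nat; case: (a' \in N b); rewrite ?leq_b1.
    by rewrite /= mul0r add0r.
  rewrite ExD (ExZr (nu b)) (Ex_cst b) => h1 h2.
  have : alpha / 4 * nu b <= (\avg_y (y \in B)%:B) * nu b by lra.
  by rewrite ler_pM2r.
move=> a y; rewrite [a \in A]inE => /andP[aN ba]; rewrite [y \in B]inE => yB.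
rewrite Ex_swap.
(* At least [alpha / 8 * nu b] of the [v] are neighbours of [y] in [N b] that do not form a bad pair
   with [a], and each of them shares at least [eps] of the [u] with [a]. *)
apply: (@le_trans _ _ (\avg_v (eps * (((v \in N b) && e v y)%:B - ((v \in N b) && bad a v)%:B)))).
  rewrite ExZl ExB -/(beta a).
  apply: (@le_trans _ _ (eps * (alpha * nu b / 4 - alpha / 8 * nu b))).
    have -> : alpha * nu b / 4 - alpha / 8 * nu b = alpha / 8 * nu b by field.
    have a80 : 0 < alpha / 8 by rewrite divr_gt0.
    have a83 : 0 < (alpha / 8) ^+ 3 by rewrite exprn_gt0.
    rewrite (exprD _ 3 3); apply: ler_pM; rewrite ?(ltW a83) //.
      have -> : eps = 4 * (alpha / 8) ^+ 3 by rewrite /eps; field.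
      by rewrite ler_peMl ?(ltW a83) // ler1n.
    rewrite exprS ler_pM2l //; apply: le_trans nub0.
    have -> : alpha ^+ 2 / 8 = 8 * (alpha / 8) ^+ 2 by field.
    by rewrite ler_peMl ?sqr_ge0 // ler1n.
  by rewrite ler_pM2l // lerB.
apply: le_Ex => v.
case vN: (v \in N b); last first.
  by rewrite subrr mulr0; apply: Ex_ge0 => u; apply: indic_ge0.
case evy: (e v y); last first.
  apply: (@le_trans _ _ 0); last by apply: Ex_ge0 => u; apply: indic_ge0.
  by rewrite /= sub0r mulrN oppr_le0 mulr_ge0 ?indic_ge0 // ltW.
rewrite /=; case: (boolP (bad a v)) => [_|].
  by rewrite subrr mulr0; apply: Ex_ge0 => u; apply: indic_ge0.
rewrite subr0 mulr1 /bad -leNgt => /le_trans; apply.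
by apply: le_Ex => u; rewrite andbT [e v u]sym_e.
Qed.

End Graph.

Section GraphEnergy.
Variables (R : realFieldType) (X H : finZmodType).
Local Notation G := (X * H)%type.
Implicit Types (f g : G -> R) (z w : G).

(** The normalisation is by the size of the graph of a map from [X] to [H], not of [X * H];
    [convolution] uses the same one. *)
Definition mass f : R := (\sum_z f z) / #|X|%:R.

Definition convolution f g z : R := (\sum_w f w * g (z - w)) / #|X|%:R.

Lemma mass_convolution f g : mass (convolution f g) = mass f * mass g.
Proof.
rewrite /mass /convolution -mulr_suml exchange_big /=.
rewrite mulf_div invfM [RHS]mulrA; congr (_ / _ / _).
rewrite mulr_suml; apply: eq_bigr => w _; rewrite -mulr_sumr; congr (_ * _).
by rewrite (reindex_inj (addIr w)); apply: eq_bigr => z _; rewrite addrK.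
Qed.

Lemma convolution_ge0 f g z :
  (forall w, 0 <= f w) -> (forall w, 0 <= g w) -> 0 <= convolution f g z.
Proof. by move=> f0 g0; rewrite divr_ge0 ?ler0n // sumr_ge0 // => w _; rewrite mulr_ge0. Qed.

Lemma convolution_ge f g z (h : X -> G) : injective h ->
    (forall w, 0 <= f w) -> (forall w, 0 <= g w) ->
  \avg_x (f (h x) * g (z - h x)) <= convolution f g z.
Proof.
move=> injh f0 g0; rewrite /convolution /Ex ler_wpM2r ?invr_ge0 ?ler0n //.
rewrite [leRHS](bigID (mem (codom h))) /= -[leLHS]addr0 lerD //; last first.
  by apply: sumr_ge0 => w _; rewrite mulr_ge0.
rewrite -(big_image _ _ _ predT (fun w => f w * g (z - w))).
rewrite -[leRHS](@big_filter _ _ _ _ (index_enum _)) le_eqVlt; apply/orP; left; apply/eqP.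
apply: perm_big; apply: uniq_perm.
- by rewrite map_inj_uniq ?enum_uniq.
- by rewrite filter_uniq ?index_enum_uniq.
by move=> w; rewrite mem_filter mem_index_enum andbT.
Qed.

Variables (A : {set X}) (xi : X -> H).

(** With this sign the points over [x + d] and [x] differ by [(d, xi x - xi (x + d))], whose second
    entry is the character that appears in [phi_energy]. *)
Definition graph_pt x : G := (x, - xi x).

Lemma graph_pt_inj : injective graph_pt. Proof. by move=> x y []. Qed.

(** The number of ways to write [z] as a difference of two points of the graph over [A], divided by
    |X|. The sum of its squares over |X| is therefore the additive energy divided by |X| cubed. *)
Definition graph_diff z : R :=
  \avg_x ([&& x \in A, x + z.1 \in A & graph_pt (x + z.1) - graph_pt x == z])%:B.

Lemma graph_diff_ge0 z : 0 <= graph_diff z.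
Proof. by apply: Ex_ge0 => x; apply: indic_ge0. Qed.

Lemma graph_diff_le1 z : graph_diff z <= 1.
Proof. exact: Ex_indic_le1. Qed.

Lemma graph_diffN z : graph_diff (- z) = graph_diff z.
Proof.
rewrite /graph_diff -(Ex_shift z.1); apply: eq_Ex => x /=.
by rewrite addrK andbCA -[graph_pt x - _]opprB eqr_opp.
Qed.

Lemma sum_graph_diff (F : G -> R) :
  (\sum_z graph_diff z * F z) / #|X|%:R =
  \avg_x \avg_y (((x \in A) && (y \in A))%:B * F (graph_pt y - graph_pt x)).
Proof.
transitivity (\avg_x ((\sum_z ([&& x \in A, x + z.1 \in A &
    graph_pt (x + z.1) - graph_pt x == z])%:B * F z) / #|X|%:R)).
  rewrite ExZr Ex_sum; congr (_ / _); apply: eq_bigr => z _.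
  by rewrite ExZr.
apply: eq_Ex => x; rewrite /Ex; congr (_ / _).
transitivity (\sum_d \sum_s ([&& x \in A, x + d \in A &
    graph_pt (x + d) - graph_pt x == (d, s)])%:B * F (d, s)).
  by rewrite pair_bigA; apply: eq_bigr => -[].
rewrite [RHS](reindex_inj (addrI x)); apply: eq_bigr => d _.
set s0 := - xi (x + d) + xi x.
have -> : graph_pt (x + d) - graph_pt x = (d, s0).
  by congr (_, _) => /=; rewrite ?opprK // addrAC subrr add0r.
rewrite (bigD1 s0) //= eqxx andbT big1 ?addr0 // => s ss0.
by rewrite xpair_eqE eqxx eq_sym (negPf ss0) !andbF mul0r.
Qed.

Lemma mass_graph_diff : mass graph_diff <= 1.
Proof.
have := sum_graph_diff (fun=> 1).
under eq_bigr do rewrite mulr1; rewrite /mass => ->.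
by apply: Ex_le => // x; apply: Ex_le => // y; rewrite mulr1 indic_le1.
Qed.

(* [alpha / 4] is the density of the set [B] of [dense_graph_paths], and the power *)
(* bounds the number of values of [xi] on it.                                      *)
Definition popularity (tau : R) (N : nat) : R :=
  let alpha := tau / 2 in
  alpha / 4 / (16 / alpha ^+ 2 / ((alpha / 8) ^+ 6 * alpha ^+ 3)) ^+ N.

Lemma popularity_gt0 tau N : 0 < tau -> 0 < popularity tau N.
Proof.
move=> tau0; have a0 : 0 < tau / 2 by rewrite divr_gt0.
have pow n : 0 < (tau / 2) ^+ n by apply: exprn_gt0.
rewrite /popularity; apply: divr_gt0; first exact: divr_gt0.
apply: exprn_gt0; apply: divr_gt0; first exact: divr_gt0.
by apply: mulr_gt0 => //; apply: exprn_gt0; apply: divr_gt0.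
Qed.

(* [N] projects [X * H] onto [H]: adding [N] copies of the graph to itself fills *)
(* a product set, which small doubling forbids unless [xi] takes few values.     *)
Lemma graph_energy_popular (tau : R) (N : nat) : 0 < tau ->
    (forall x : X, x *+ N = 0) -> (forall h : H, h *+ N = h) ->
    tau <= (\sum_z graph_diff z ^+ 2) / #|X|%:R ->
  exists s, popularity tau N <= \avg_x ((x \in A) && (xi x == s))%:B.
Proof.
move=> tau0 NX NH energy; pose alpha := tau / 2.
have a0 : 0 < alpha by rewrite divr_gt0.
have X0 : 0 < #|X|%:R :> R by rewrite ltr0n; apply/card_gt0P; exists 0.
pose e x y := [&& x \in A, y \in A & alpha <= graph_diff (graph_pt y - graph_pt x)].
have sym_e : symmetric e.
  by move=> x y; rewrite /e andbCA -graph_diffN opprB.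
have dense : alpha <= \avg_x \avg_y (e x y)%:B.
  have -> : alpha = tau - alpha by rewrite /alpha; field.
  rewrite lerBlDr (le_trans energy) //.
  under eq_bigr do rewrite expr2.
  rewrite sum_graph_diff -[X in _ + X](@Ex_cst _ _ (0 : X)) -ExD.
  apply: le_Ex => x; rewrite -[X in _ + X](@Ex_cst _ _ (0 : X)) -ExD.
  apply: le_Ex => y; rewrite /e.
  case: (x \in A) => /=; last by rewrite mul0r add0r ltW.
  case: (y \in A) => /=; last by rewrite mul0r add0r ltW.
  rewrite mul1r; case: (leP alpha (graph_diff _)) => [_|/ltW] /=; last by rewrite add0r.
  by rewrite (le_trans (graph_diff_le1 _)) // lerDl ltW.
have [A' [B' [A'big B'big paths]]] := dense_graph_paths a0 sym_e dense.
set kappa := (alpha / 8) ^+ 6 in paths.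
have k0 : 0 < kappa by rewrite exprn_gt0 // divr_gt0.
have A'0 : A' != set0.
  apply: contraTneq A'big => ->; rewrite Ex_indic cards0 mul0r -ltNge.
  by rewrite divr_gt0 ?exprn_gt0.
have B'0 : B' != set0.
  apply: contraTneq B'big => ->; rewrite Ex_indic cards0 mul0r -ltNge.
  by rewrite divr_gt0.
have sB'A b : b \in B' -> b \in A.
  move=> b'B; have [a a'A] := set0Pn _ A'0.
  have [u] := Ex_exists k0 (paths a b a'A b'B).
  move/(Ex_exists k0) => [v]; case: (boolP (b \in A)) => // bA.
  by rewrite /e (negPf bA) !andbF leNgt k0.
pose P := [set - graph_pt a | a in A'].
pose Q := [set graph_pt b | b in B'].
have cardP : #|P| = #|A'|.
  by rewrite card_imset // => x y /oppr_inj/graph_pt_inj.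
have P0 : P != set0 by rewrite -card_gt0 cardP card_gt0.
(* A path a, u, v, b writes the difference of the points over [b] and [a] as a sum of three popular
   differences. Hence [r3] is at least [kappa * alpha ^+ 3] on all of [sumset P Q], while its mass
   is at most 1. *)
have cardPQ : #|sumset P Q|%:R * (kappa * alpha ^+ 3) <= #|X|%:R.
  pose r3 := convolution graph_diff (convolution graph_diff graph_diff).
  have r3_ge0 z : 0 <= r3 z.
    apply: convolution_ge0 => w; first exact: graph_diff_ge0.
    by apply: convolution_ge0 => ?; apply: graph_diff_ge0.
  have : mass r3 <= 1.
    rewrite /r3 !mass_convolution; have := mass_graph_diff.
    have : 0 <= mass graph_diff.
      by rewrite divr_ge0 ?ler0n // sumr_ge0 // => z _; apply: graph_diff_ge0.
    by move: (mass _) => t t0 t1; rewrite !mulr_ile1 ?mulr_ge0.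
  rewrite /mass ler_pdivrMr // mul1r; apply: le_trans.
  rewrite [leRHS](bigID (mem (sumset P Q))) /= -[leLHS]addr0 lerD ?sumr_ge0 //.
  rewrite mulr_natl -sumr_const; apply: ler_sum
    => _ /imset2P[_ _ /imsetP[a a'A ->] /imsetP[b b'B ->] ->].
  pose h x := graph_pt x - graph_pt a.
  have injh c : injective (fun x => graph_pt x - c) by move=> x y /addIr/graph_pt_inj.
  apply: le_trans (convolution_ge (- graph_pt a + graph_pt b) (injh (graph_pt a))
    graph_diff_ge0 _); last first.
    by move=> w; apply: convolution_ge0 => ?; apply: graph_diff_ge0.
  apply: (@le_trans _ _ (\avg_u \avg_v (([&& e a u, e u v & e v b])%:B * alpha ^+ 3))).
    rewrite (@eq_Ex _ _ _ (fun u => (\avg_v ([&& e a u, e u v & e v b])%:B) * alpha ^+ 3)); last first.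
      by move=> u; rewrite ExZr.
    by rewrite ExZr ler_pM2r ?exprn_gt0 // paths.
  apply: le_Ex => u; rewrite opprB [- graph_pt a + _]addrC addrA subrK.
  apply: (@le_trans _ _ (graph_diff (graph_pt u - graph_pt a) *
     \avg_v (graph_diff (graph_pt v - graph_pt u) * graph_diff (graph_pt b - graph_pt v)))).
    rewrite -ExZl; apply: le_Ex => v.
    have ge0 x y z : 0 <= graph_diff x * (graph_diff y * graph_diff z).
      by apply: mulr_ge0; last apply: mulr_ge0; apply: graph_diff_ge0.
    case eau: (e a u); last by rewrite mul0r ge0.
    case euv: (e u v); last by rewrite mul0r ge0.
    case evb: (e v b); last by rewrite mul0r ge0.
    case/and3P: eau => _ _ au; case/and3P: euv => _ _ uv; case/and3P: evb => _ _ vb.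
    rewrite mul1r !exprS expr0 mulr1.
    by apply: ler_pM => //; [exact: ltW | rewrite mulr_ge0 ?ltW | apply: ler_pM => //; exact: ltW].
  rewrite ler_wpM2l ?graph_diff_ge0 //.
  have := convolution_ge (graph_pt b - graph_pt u) (injh (graph_pt u)) graph_diff_ge0 graph_diff_ge0.
  apply: le_trans; apply: le_Ex => v.
  by rewrite opprB addrA subrK.
set K := 16 / alpha ^+ 2 / (kappa * alpha ^+ 3).
have ka0 : 0 < kappa * alpha ^+ 3 by rewrite (mulr_gt0 k0) ?exprn_gt0.
have a20 : 0 < 16 / alpha ^+ 2 by rewrite divr_gt0 ?exprn_gt0.
have K0 : 0 < K by apply: divr_gt0.
have leK : #|sumset P Q|%:R <= K * #|P|%:R.
  rewrite cardP /K mulrAC ler_pdivlMr //.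
  apply: le_trans cardPQ _.
  move: A'big; rewrite Ex_indic ler_pdivlMr // => /(ler_wpM2l (ltW a20)).
  apply: le_trans.
  by rewrite le_eqVlt; apply/orP; left; apply/eqP; field; rewrite gt_eqF.
have [P' [sP'P P'0 growth]] := plunnecke P0 leK.
pose S := xi @: B'.
(* [(0, - xi b)] is the N-th multiple of the graph point of [b], so [P'] translated by all these
   vectors stays in [P'] plus the N-fold sum of [Q]. The translates are disjoint because [P'] is
   part of a graph. *)
have cardS : #|S|%:R <= K ^+ N.
  have P'0R : 0 < #|P'|%:R :> R by rewrite ltr0n card_gt0.
  rewrite -(ler_pM2r P'0R); apply: le_trans (growth N).
  rewrite -natrM mulnC -cardsX ler_nat.
  pose shift (p : G * H) : G := p.1 + (0, - p.2).
  rewrite -(@card_in_imset _ _ shift); last first.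
    move=> [z s] [z' s']; rewrite !inE /= => /andP[zP' _] /andP[z'P' _].
    have /imsetP[a _ ->] := subsetP sP'P _ zP'.
    have /imsetP[a' _ ->] := subsetP sP'P _ z'P'.
    rewrite /shift /= => -[]; rewrite !addr0 => /oppr_inj -> /addrI/oppr_inj -> //.
  apply/subset_leq_card/subsetP=> w /imsetP[[z s] zs defw]; rewrite {w}defw.
  move: zs; rewrite !inE /= => /andP[zP' /imsetP[b b'B ->]].
  rewrite /shift /=; apply: mem_sumset => //.
  have -> : (0, - xi b) = graph_pt b *+ N.
    have -> : graph_pt b *+ N = (b *+ N, (- xi b) *+ N).
      by elim: (N) => [|k IHk]; rewrite ?mulr0n // !mulrS IHk.
    by rewrite NX NH.
  by apply: mem_multiple_sum; apply: imset_f.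
have [//|noS] := pickP (fun s => popularity tau N <= \avg_x ((x \in A) && (xi x == s))%:B).
  by move=> s ps; exists s.
(* If every value were unpopular, the at most [K ^+ N] level sets of [xi] on [B'] would be too small
   to fill it. *)
suff : \avg_x (x \in B')%:B < alpha / 4 by rewrite ltNge B'big.
have -> : \avg_x (x \in B')%:B = \sum_(s in S) \avg_x ((x \in B') && (xi x == s))%:B :> R.
  rewrite -Ex_sum; apply: eq_Ex => x.
  case: (boolP (x \in B')) => /= [xB|_]; last by rewrite big1.
  rewrite (bigD1 (xi x)) ?imset_f //= eqxx big1 ?addr0 // => s /andP[_].
  by rewrite eq_sym => /negPf->.
apply: (@lt_le_trans _ _ (\sum_(s in S) popularity tau N)).
  apply: ltr_sum => [|s _].
    have [b b'B] := set0Pn _ B'0; apply/hasP; exists (xi b); rewrite ?mem_index_enum //.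
    exact: imset_f.
  apply: le_lt_trans (_ : _ <= \avg_x ((x \in A) && (xi x == s))%:B) _.
    apply: le_Ex => x; rewrite ler_nat; case: (boolP (x \in B')) => // /sB'A ->.
    by [].
  by rewrite ltNge noS.
rewrite sumr_const -[_ *+ _]mulr_natl /popularity -/alpha -/kappa -/K mulrCA -[leRHS]mulr1.
rewrite ler_pM2l ?divr_gt0 // ler_pdivrMr ?exprn_gt0 // mul1r //.
Qed.

End GraphEnergy.

(** * Characters of a finite abelian group of bounded torsion *)

Lemma prim_root_exists (F : numClosedFieldType) n :
  (0 < n)%N -> {z : F | n.-primitive_root z}.
Proof.
pose p : {poly F} := 'X^n - 1; have [r Dp] := closed_field_poly_normal p.
move=> n_gt0; apply/sigW; rewrite (monicP _) ?monicXnsubC // scale1r in Dp.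
have rn1: all n.-unity_root r by apply/allP=> z; rewrite -root_prod_XsubC -Dp.
have sz_r: (n < (size r).+1)%N.
  by rewrite -(size_prod_XsubC r id) -Dp size_XnsubC.
have [|z] := hasP (has_prim_root n_gt0 rn1 _ sz_r); last by exists z.
by rewrite -separable_prod_XsubC -Dp separable_Xn_sub_1 // pnatr_eq0 -lt0n.
Qed.

Section Characters.
Variables (R : rcfType) (Y : finZmodType) (m' : nat).
Local Notation C := R[i].
Local Notation m := m'.+1.
(* The Pontryagin dual of a group of torsion [m] is modelled inside the group of *)
(* all functions to Z/m, where it consists of the additive ones.                 *)
Local Notation H := {ffun Y -> 'I_m}.
Implicit Types xi : H.

Definition is_char xi := [forall y, forall y', xi (y + y') == xi y + xi y'].

Lemma is_charP xi : reflect {morph xi : y y' / y + y'} (is_char xi).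
Proof.
apply: (iffP 'forall_forallP) => [h y y'|h y y']; first exact/eqP.
by rewrite h.
Qed.

Lemma is_char0 : is_char 0.
Proof. by apply/is_charP => y y'; rewrite !ffunE addr0. Qed.

Lemma is_charD xi xi' : is_char xi -> is_char xi' -> is_char (xi + xi').
Proof.
move=> /is_charP h /is_charP h'; apply/is_charP => y y'.
by rewrite !ffunE h h' addrACA.
Qed.

Lemma is_charN xi : is_char (- xi) = is_char xi.
Proof.
have hN f : is_char f -> is_char (- f).
  by move=> /is_charP h; apply/is_charP => y y'; rewrite !ffunE h opprD.
by apply/idP/idP => /hN //; rewrite opprK.
Qed.

Definition omega : C := sval (prim_root_exists C (ltn0Sn m')).

Lemma omega_prim : m.-primitive_root omega.
Proof. by rewrite /omega; case: (prim_root_exists _ _). Qed.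

Definition echar xi y : C := omega ^+ (xi y).

Lemma echarD xi xi' y : echar (xi + xi') y = echar xi y * echar xi' y.
Proof. by rewrite /echar ffunE /= (prim_expr_mod omega_prim) exprD. Qed.

Lemma echar0 y : echar 0 y = 1.
Proof. by rewrite /echar ffunE. Qed.

Lemma mo_omega : mo omega = 1.
Proof.
apply/eqP; rewrite -(@pexpr_eq1 _ (mo omega) m) ?mo_ge0 //.
by rewrite -moX (prim_expr_order omega_prim) mo1.
Qed.

Lemma mo_echar xi y : mo (echar xi y) = 1.
Proof. by rewrite moX mo_omega expr1n. Qed.

Lemma echar_conj xi y : (echar xi y)^* = echar (- xi) y.
Proof.
have e1 : echar xi y * echar (- xi) y = 1 by rewrite -echarD subrr echar0.
have e2 : echar xi y * (echar xi y)^* = 1 by rewrite -sqr_mo mo_echar expr1n.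
have e0 : echar xi y != 0.
  by apply: contra_eq_neq e1 => ->; rewrite mul0r eq_sym oner_neq0.
by apply: (mulfI e0); rewrite e1 e2.
Qed.

Lemma echar_add xi y y' : is_char xi -> echar xi (y + y') = echar xi y * echar xi y'.
Proof. by move/is_charP=> h; rewrite /echar h /= (prim_expr_mod omega_prim) exprD. Qed.

Lemma echar_opp xi y : is_char xi -> echar xi (- y) = echar (- xi) y.
Proof.
move=> /is_charP h; rewrite /echar ffunE; congr (omega ^+ (_ : 'I__)).
have h0 : xi 0 = 0 by apply: (addrI (xi 0)); rewrite -h !addr0.
by apply/eqP; rewrite -addr_eq0 -h addNr h0.
Qed.

Lemma echar_neq1 xi y : xi y != 0 -> echar xi y != 1.
Proof.
apply: contraNneq => /eqP; rewrite -(expr0 omega) (eq_prim_root_expr omega_prim).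
by rewrite mod0n modn_small // => /eqP h; apply/eqP/val_inj.
Qed.

Hypothesis torsionY : forall y : Y, y *+ m = 0.

(** The irreducible characters of an abelian group are linear and have trivial common kernel. By
    torsion their values are m-th roots of unity; taking exponents yields an additive map to Z/m,
    which moves the result from algebraic numbers to [R[i]]. *)
Lemma char_separates y : y != 0 -> exists2 xi, is_char xi & echar xi y != 1.
Proof.
move=> y0; have cYY : abelian [set: Y] by exact: FinRing.Theory.zmod_abelian.
have [i chi_y] : exists i : Iirr [set: Y], y \notin cfker 'chi_i.
  apply/existsP; rewrite -negb_forall; apply: contra y0 => /forallP kery.
  have : y \in \bigcap_i cfker 'chi[[set: Y]]_i by apply/bigcapP => i _.
  by rewrite TI_cfker_irr inE.
have lin_i := char_abelianP _ cYY i.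
have [w w_prim] := C_prim_root_exists (ltn0Sn m').
have chi_m z : 'chi_i z ^+ m = 1.
  rewrite -(lin_charX lin_i) ?inE // FinRing.Theory.zmodXgE torsionY.
  exact: (lin_char1 lin_i).
pose xi := [ffun z => sval (prim_rootP w_prim (chi_m z))] : H.
have chiE z : 'chi_i z = w ^+ xi z by rewrite ffunE; case: (prim_rootP _ _).
exists xi.
  apply/is_charP => z z'; apply/val_inj => /=; apply/eqP.
  rewrite -[X in X == _](@modn_small _ m) // -(eq_prim_root_expr w_prim) -chiE exprD -!chiE.
  by rewrite -(lin_charM lin_i) ?inE.
apply: echar_neq1; apply: contra chi_y => /eqP xiy.
by rewrite cfkerEirr inE (lin_char1 lin_i) chiE xiy.
Qed.

Lemma avg_char xi : is_char xi -> \avg_y echar xi y = (xi == 0)%:B.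
Proof.
move=> chi; case: eqVneq => [->|xi0].
  by rewrite (eq_Ex echar0) (@Ex_cst _ Y 0).
have [y0 y0P] : exists y, xi y != 0.
  apply/existsP; rewrite -negb_forall; apply: contra xi0 => /forallP h.
  by apply/eqP/ffunP => y; rewrite ffunE; apply/eqP/h.
have := Ex_shift y0 (echar xi).
rewrite (eq_Ex (fun y => echar_add y y0 chi)) ExZr => /eqP.
rewrite -{2}[Ex _]mulr1 -subr_eq0 -mulrBr mulf_eq0 subr_eq0 (negPf (echar_neq1 y0P)) orbF.
by move/eqP.
Qed.

Lemma sum_char y : \sum_(xi | is_char xi) echar xi y = (y == 0)%:B * #|Y|%:R.
Proof.
have sum0 z : z != 0 -> \sum_(xi | is_char xi) echar xi z = 0.
  move=> /char_separates[xi0 chi0 neq1].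
  set S := \sum_(xi | _) _.
  have : S * echar xi0 z = S.
    rewrite /S mulr_suml [RHS](reindex_inj (addIr xi0)) /=.
    rewrite [RHS](eq_bigl is_char) => [|xi]; first by apply: eq_bigr => xi _; rewrite echarD.
    apply/idP/idP => [h|/is_charD->//]; rewrite -(addrK xi0 xi) is_charD ?is_charN //.
  move/eqP; rewrite -{2}[S]mulr1 -subr_eq0 -mulrBr mulf_eq0 subr_eq0 (negPf neq1) orbF.
  by move/eqP.
have [->|/sum0->] := eqVneq y 0; last by rewrite mul0r.
rewrite mul1r.
have Y0 : #|Y|%:R != 0 :> C by rewrite pnatr_eq0 -lt0n; apply/card_gt0P; exists 0.
(* Averaging over [y] determines the value at 0, that is the number of characters, from
   orthogonality alone. *)
have : \avg_y \sum_(xi | is_char xi) echar xi y = 1.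
  rewrite Ex_sum (bigD1 0) ?is_char0 //= avg_char ?is_char0 // eqxx.
  by rewrite big1 ?addr0 // => xi /andP[chi xi0]; rewrite avg_char // (negPf xi0).
rewrite /Ex (bigD1 0) //= [X in _ + X]big1 ?addr0 => [/(canRL (divfK Y0))->|z]; last exact: sum0.
by rewrite mul1r.
Qed.

Definition fourier (f : Y -> C) xi : C := \avg_y (f y * echar xi y).

Lemma fourier_inversion (f : Y -> C) y :
  f y = \sum_(xi | is_char xi) fourier f xi * echar (- xi) y.
Proof.
rewrite /fourier.
under eq_bigr do rewrite -ExZr.
rewrite -Ex_sum.
under eq_Ex => z.
  under eq_bigr => xi chi do rewrite -mulrA -echar_opp // -echar_add //.
  rewrite -mulr_sumr sum_char subr_eq0.
  over.
rewrite /Ex (bigD1 y) //= big1 ?addr0 => [|z /negPf->]; last by rewrite mul0r mulr0.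
rewrite eqxx mul1r mulfK //.
by rewrite pnatr_eq0 -lt0n; apply/card_gt0P; exists 0.
Qed.

Lemma parseval (f : Y -> C) :
  \sum_(xi | is_char xi) mo (fourier f xi) ^+ 2 = \avg_y (mo (f y) ^+ 2).
Proof.
apply: complexI; rewrite rmorph_sum real_complex_avg /=.
under [RHS]eq_Ex => y.
  rewrite sqr_mo {1}(fourier_inversion f y) mulr_suml.
  over.
rewrite Ex_sum; apply: eq_bigr => xi chi.
rewrite sqr_mo {2}/fourier conj_avg.
under eq_Ex do rewrite rmorphM /= echar_conj.
by rewrite -ExZl; apply: eq_Ex => y; ring.
Qed.

(** The average equals the sum over xi of the transforms of [f] at xi, [g] at -xi and [h] at xi.
    Extract the largest coefficient of [f]; by AM-GM and Parseval the rest sums to at most 1. *)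
Lemma fourier_large (f g h : Y -> C) :
    (forall y, mo (g y) <= 1) -> (forall y, mo (h y) <= 1) ->
  exists2 xi, is_char xi &
    mo (\avg_y \avg_n (f y * g (y + n) * h n)) <= mo (fourier f xi).
Proof.
move=> g1 h1.
have [xi chi ximax] := Order.TotalTheory.arg_maxP (fun xi => mo (fourier f xi)) is_char0.
exists xi => //; set M := mo (fourier f xi).
have -> : \avg_y \avg_n (f y * g (y + n) * h n) =
   \sum_(xi | is_char xi) fourier f xi * (fourier g (- xi) * fourier h xi).
  transitivity (\avg_y \avg_n \sum_(xi | is_char xi)
     fourier f xi * (g (y + n) * echar (- xi) (y + n) * (h n * echar xi n))).
    apply: eq_Ex => y; apply: eq_Ex => n.
    rewrite (fourier_inversion f y) !mulr_suml; apply: eq_bigr => eta ceta.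
    rewrite echar_add ?is_charN //.
    have e1 : echar (- eta) n * echar eta n = 1 by rewrite -echarD addNr echar0.
    transitivity (fourier f eta * echar (- eta) y * g (y + n) * h n * (echar (- eta) n * echar eta n)).
      by rewrite e1 mulr1.
    by ring.
  under eq_Ex do rewrite Ex_sum.
  rewrite Ex_sum; apply: eq_bigr => eta ceta.
  rewrite Ex_swap -!ExZl; apply: eq_Ex => n.
  rewrite (Ex_shift n (fun y => fourier f eta * (g y * echar (- eta) y * (h n * echar eta n)))).
  by rewrite ExZl ExZr.
apply: le_trans (mo_sum _ _ _) _.
apply: (@le_trans _ _ (\sum_(xi | is_char xi)
    M * (mo (fourier g (- xi)) ^+ 2 / 2 + mo (fourier h xi) ^+ 2 / 2))).
  apply: ler_sum => eta ceta; rewrite (moM (fourier f eta)) (moM (fourier g _)).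
  apply: ler_pM; rewrite ?mulr_ge0 ?mo_ge0 //.
    exact: (ximax eta ceta).
  by have := sqr_ge0 (mo (fourier g (- eta)) - mo (fourier h eta)); nra.
rewrite -mulr_sumr ler_piMr ?mo_ge0 // big_split /= -!mulr_suml parseval.
rewrite (reindex_inj oppr_inj) /=; under eq_bigl do rewrite is_charN.
under eq_bigr do rewrite opprK.
rewrite parseval.
have le1 (k : Y -> C) : (forall y, mo (k y) <= 1) -> \avg_y (mo (k y) ^+ 2) <= 1.
  by move=> k1; apply: Ex_le => // y; rewrite expr_le1 ?mo_ge0.
by have := le1 _ g1; have := le1 _ h1; lra.
Qed.

End Characters.

(** * Dual functions on a product of two groups *)

Section DualFunctions.
Variable R : rcfType.
Local Notation C := R[i].

(* Functions generated from constants by [F x = E_h f (x + h) * D_h x]: they pair *)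
(* only with functions of large U^s norm, and contain the dual functions of U^s.  *)
Fixpoint isdual (G : finZmodType) (s : nat) (F : G -> C) : Prop :=
  match s with
  | 0 => exists2 c, mo c <= 1 & forall x, F x = c
  | s'.+1 => exists (W : finType) (f : W -> G -> C) (D : W -> G -> G -> C),
      [/\ forall w x, mo (f w x) <= 1, forall w h, isdual s' (D w h) &
          forall x, F x = \avg_w \avg_h (f w (x + h) * D w h x)]
  end.

Lemma mo_mul_le1 (z w : C) : mo z <= 1 -> mo w <= 1 -> mo (z * w) <= 1.
Proof. by move=> z1 w1; rewrite moM mulr_ile1 ?mo_ge0. Qed.

Lemma mo_avg_le1 (T : finType) (f : T -> C) :
  (forall x, mo (f x) <= 1) -> mo (\avg_x f x) <= 1.
Proof. by move=> f1; apply: le_trans (mo_avg _) _; apply: Ex_le. Qed.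

Lemma mo_conj_le1 (z : C) : mo z <= 1 -> mo (z^*) <= 1.
Proof. by rewrite moJ. Qed.

Lemma isdual_le1 (G : finZmodType) s (F : G -> C) x : isdual s F -> mo (F x) <= 1.
Proof.
elim: s F => [|s IHs] F /=; first by case=> c c1 ->.
case=> W [f [D [f1 dualD ->]]]; apply: mo_avg_le1 => w; apply: mo_avg_le1 => h.
by apply: mo_mul_le1 => //; apply: IHs.
Qed.

Lemma sqr_mo_avgE (T : finType) (f : T -> C) :
  (mo (\avg_x f x) ^+ 2)%:C%C = \avg_x \avg_x' (f x * (f x')^*).
Proof. by rewrite sqr_mo conj_avg Ex_mul. Qed.

Lemma le_sqr_avg (T : finType) (f : T -> R) c :
  0 <= c -> c <= \avg_x f x -> c ^+ 2 <= \avg_x (f x ^+ 2).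
Proof.
move=> c0 cf; apply: le_trans (Ex_sqr _); rewrite lerXn2r ?nnegrE //.
exact: le_trans cf.
Qed.

Section Product.
Variables X Y : finZmodType.
Implicit Types (g : X -> Y -> C) (F : X * Y -> C).

Definition pairing g F : C := \avg_x \avg_y (g x y * F (x, y)).

(* The recursions below replace [g] by residues of orthogonal projections on each *)
(* column, which need not be bounded pointwise.                                  *)
Definition column_bounded g := forall y, \avg_x (mo (g x y) ^+ 2) <= 1.

Lemma column_bounded_mul g f : column_bounded g ->
  (forall x y, mo (f x y) <= 1) -> column_bounded (fun x y => g x y * f x y).
Proof.
move=> g1 f1 y; apply: le_trans (g1 y); apply: le_Ex => x.
by rewrite moM exprMn ler_piMr ?sqr_ge0 // expr_le1 ?mo_ge0.
Qed.

Lemma bounded_column_bounded g :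
  (forall x y, mo (g x y) <= 1) -> column_bounded g.
Proof. by move=> g1 y; apply: Ex_le => // x; rewrite expr_le1 ?mo_ge0. Qed.

Lemma pairing_le1 g F : column_bounded g -> (forall p, mo (F p) <= 1) ->
  mo (pairing g F) <= 1.
Proof.
move=> g1 F1; rewrite /pairing Ex_swap; apply: mo_avg_le1 => y.
apply: le_trans (mo_avg _) _.
apply: (@le_trans _ _ (\avg_x (2^-1 + 2^-1 * mo (g x y) ^+ 2))).
  apply: le_Ex => x; rewrite moM; have := F1 (x, y).
  have := mo_ge0 (g x y); have := mo_ge0 (F (x, y)); have := sqr_ge0 (mo (g x y) - 1).
  nra.
by rewrite ExD ExZl (@Ex_cst _ _ (0 : X)); have := g1 y; lra.
Qed.

Lemma pairing_dual (g : X -> Y -> C) (F : X * Y -> C) (W : finType)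
    (f : W -> X * Y -> C) (D : W -> X * Y -> X * Y -> C) :
    (forall p, F p = \avg_w \avg_h (f w (p + h) * D w h p)) ->
  pairing g F = \avg_w \avg_a \avg_b
    pairing (fun x y => g x y * f w (x + a, y + b)) (D w (a, b)).
Proof.
move=> defF; rewrite /pairing.
under eq_Ex => x.
  under eq_Ex => y do rewrite defF -ExZl.
  rewrite Ex_swap.
  over.
rewrite Ex_swap; apply: eq_Ex => w.
under eq_Ex => x.
  under eq_Ex => y.
    rewrite -ExZl -(@eq_Ex _ _ (fun h =>
      g x y * (f w ((x, y) + (h.1, h.2)) * D w (h.1, h.2) (x, y)))).
      rewrite (Ex_pair (fun a b => g x y * (f w ((x, y) + (a, b)) * D w (a, b) (x, y)))).
      over.
    by case=> a b.
  rewrite Ex_swap.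
  over.
rewrite Ex_swap; apply: eq_Ex => a.
under eq_Ex do rewrite Ex_swap.
rewrite Ex_swap; apply: eq_Ex => b.
by apply: eq_Ex => x; apply: eq_Ex => y; rewrite mulrA.
Qed.

Lemma shift_right s g F nu : 0 < nu -> isdual s.+1 F -> nu <= mo (pairing g F) ->
  exists (f : X -> Y -> C) (D : Y -> X * Y -> C),
    [/\ forall x y, mo (f x y) <= 1, forall n, isdual s (D n) &
        nu <= mo (\avg_n pairing (fun x y => g x y * f x (y + n)) (D n))].
Proof.
move=> nu0 [W [f [D [f1 dualD defF]]]]; rewrite (pairing_dual g defF).
move=> /(mo_avg_exists nu0)[w /(mo_avg_exists nu0)[a lea]].
exists (fun x y => f w (x + a, y)), (fun n => D w (a, n)).
by split=> [x y|n|]; [exact: f1 | exact: dualD | exact: lea].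
Qed.

Lemma shift_left s g F nu : 0 < nu -> isdual s.+1 F -> nu <= mo (pairing g F) ->
  exists (f : X -> Y -> C) (D : X -> X * Y -> C),
    [/\ forall x y, mo (f x y) <= 1, forall m, isdual s (D m) &
        nu <= mo (\avg_m pairing (fun x y => g x y * f (x + m) y) (D m))].
Proof.
move=> nu0 [W [f [D [f1 dualD defF]]]]; rewrite (pairing_dual g defF).
move=> /(mo_avg_exists nu0)[w]; rewrite Ex_swap => /(mo_avg_exists nu0)[b leb].
exists (fun x y => f w (x, y + b)), (fun m => D w (m, b)).
by split=> [x y|m|]; [exact: f1 | exact: dualD | exact: leb].
Qed.

End Product.

(** This is the correlation of [g] with [u x * v y] when [v y] is the conjugate of
    [E_x g x y * u x], so only [u] has to be recorded. *)
Definition detected (X Y : finZmodType) (g : X -> Y -> C) (eta : R) : Prop :=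
  exists2 u : X -> C, forall x, mo (u x) <= 1 &
    eta <= \avg_y (mo (\avg_x (g x y * u x)) ^+ 2).

Definition product_detects (m1 m2 s : nat) : Prop :=
  forall nu : R, 0 < nu -> exists2 eta : R, 0 < eta &
    forall X Y : finZmodType,
      (forall x : X, x *+ m1 = 0) -> (forall y : Y, y *+ m2 = 0) ->
    forall F (g : X -> Y -> C), isdual s F -> column_bounded g ->
      nu <= mo (pairing g F) -> detected g eta.

Lemma product_detects0 m1 m2 : product_detects m1 m2 0.
Proof.
move=> nu nu0; exists (nu ^+ 2); first exact: exprn_gt0.
move=> X Y _ _ F g [c c1 Fc] _ le_nu; exists (fun=> 1) => [x|]; first by rewrite mo1.
have : nu <= mo (\avg_y \avg_x (g x y * 1)).
  apply: le_trans le_nu _; rewrite /pairing Ex_swap.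
  under eq_Ex => y do under eq_Ex => x do rewrite Fc.
  under eq_Ex do rewrite ExZr.
  rewrite ExZr moM.
  under [in leRHS]eq_Ex do rewrite ExZr mulr1.
  by rewrite ler_piMr ?mo_ge0.
move=> le_nu1; apply: le_sqr_avg; first exact: ltW.
exact: le_trans le_nu1 (mo_avg _).
Qed.

Section Step.
Variables (m1 m2 s : nat).
Hypothesis IH : product_detects m1 m2 s.

Lemma detected_family nu : 0 < nu -> exists2 kappa : R, 0 < kappa &
  forall X Y : finZmodType,
    (forall x : X, x *+ m1 = 0) -> (forall y : Y, y *+ m2 = 0) ->
  forall (N : finType) (g : N -> X -> Y -> C) (D : N -> X * Y -> C),
    (forall n, column_bounded (g n)) -> (forall n, isdual s (D n)) ->
    nu <= mo (\avg_n pairing (g n) (D n)) ->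
  exists2 u : N -> X -> C, forall n x, mo (u n x) <= 1 &
    kappa <= \avg_n \avg_y (mo (\avg_x (g n x y * u n x)) ^+ 2).
Proof.
move=> nu0; have nu20 : 0 < nu / 2 by rewrite divr_gt0.
have [eta eta0 detect] := IH nu20.
exists (eta * (nu / 2)); first exact: mulr_gt0.
move=> X Y torX torY N g D g1 dualD le_nu.
(* A bound linear in the pairing can be averaged over [n] directly. It follows from [detect] where
   the pairing is at least [nu / 2], as pairings are at most 1; elsewhere it is negative and [u = 0]
   will do. *)
have /fin_all_exists[u uP] : forall n, exists u : X -> C, (forall x, mo (u x) <= 1) /\
    eta * (mo (pairing (g n) (D n)) - nu / 2) <= \avg_y (mo (\avg_x (g n x y * u x)) ^+ 2).
  move=> n.
  have pos u : 0 <= \avg_y (mo (\avg_x (g n x y * u x)) ^+ 2).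
    by apply: Ex_ge0 => y; apply: sqr_ge0.
  have [le_t|lt_t] := leP (nu / 2) (mo (pairing (g n) (D n))).
    have [u u1 le_eta] := detect X Y torX torY (D n) (g n) (dualD n) (g1 n) le_t.
    exists u; split => //; apply: le_trans le_eta.
    rewrite ler_piMr ?(ltW eta0) // lerBlDr (@le_trans _ _ 1) ?lerDl ?(ltW nu20) //.
    by apply: pairing_le1 => // p; apply: isdual_le1 (dualD n).
  exists (fun=> 0); split=> [x|]; first by rewrite mo0.
  apply: le_trans (pos _); rewrite mulr_ge0_le0 ?(ltW eta0) // subr_le0 ltW //.
exists u => [n|]; first by case: (uP n).
have [n0 _|N0] := pickP N; last first.
  by move: le_nu; rewrite /Ex (big_pred0 _ _ _ _ N0) mul0r mo0 leNgt nu0.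
apply: (@le_trans _ _ (\avg_n (eta * (mo (pairing (g n) (D n)) - nu / 2)))); last first.
  by apply: le_Ex => n; case: (uP n).
rewrite ExZl ExB (Ex_cst n0) ler_pM2l //.
by have := le_trans le_nu (mo_avg _); lra.
Qed.

End Step.

End DualFunctions.

(** * The induction step *)

Section CharacterCorrelation.
Variable R : rcfType.
Local Notation C := R[i].
Variables (m1 m2' s : nat).
Local Notation m2 := m2'.+1.
Hypothesis IH : product_detects R m1 m2 s.

(* A shift in [Y] followed by the induction hypothesis and Cauchy-Schwarz leaves *)
(* [g x y * (g x' y)^*] correlating with a character of [Y], for most [x], [x'].  *)
Lemma character_correlation nu : 0 < nu -> exists2 c : R, 0 < c &
  forall X Y : finZmodType,
    (forall x : X, x *+ m1 = 0) -> (forall y : Y, y *+ m2 = 0) ->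
  forall (F : X * Y -> C) (g : X -> Y -> C), isdual s.+1 F -> column_bounded g ->
    nu <= mo (pairing g F) ->
  exists (xi : X -> {ffun Y -> 'I_m2}) (a : X -> C),
    [/\ forall x, is_char (xi x), forall x, mo (a x) <= 1 &
        c <= \avg_y (mo (\avg_x (g x y * (a x * echar R (xi x) y))) ^+ 2)].
Proof.
move=> nu0; have [kappa k0 family] := detected_family IH nu0.
exists (kappa ^+ 2); first exact: exprn_gt0.
move=> X Y torX torY F g dualF g1 /(shift_right nu0 dualF)[f [D [f1 dualD le_nu]]].
have [n|u u1 le_k] := family X Y torX torY Y _ D _ dualD le_nu.
  exact: column_bounded_mul.
pose z x' x := \avg_y \avg_n (g x y * (g x' y)^* *
  (f x (y + n) * (f x' (y + n))^*) * (u n x * (u n x')^*)).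
have le_z : kappa <= \avg_x' \avg_x mo (z x' x).
  apply: (@le_trans _ _ (mo (\avg_x' \avg_x z x' x))); last first.
    by apply: le_trans (mo_avg _) _; apply: le_Ex => x'; apply: mo_avg.
  apply: le_trans le_k _; rewrite le_eqVlt; apply/orP; left; apply/eqP.
  rewrite -[LHS]mo_real; last first.
    by apply: Ex_ge0 => n; apply: Ex_ge0 => y; apply: sqr_ge0.
  congr (mo _); rewrite real_complex_avg.
  under eq_Ex do rewrite real_complex_avg.
  under eq_Ex => n do under eq_Ex => y do rewrite sqr_mo_avgE Ex_swap.
  under eq_Ex do rewrite Ex_swap.
  rewrite Ex_swap; apply: eq_Ex => x'.
  under eq_Ex do rewrite Ex_swap.
  under eq_Ex => n do under eq_Ex => x do under eq_Ex => y do rewrite !rmorphM.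
  under eq_Ex do rewrite Ex_swap.
  under eq_Ex do rewrite Ex_swap.
  rewrite Ex_swap; apply: eq_Ex => x; rewrite Ex_swap /z.
  by apply: eq_Ex => y; apply: eq_Ex => n /=; ring.
have /fin_all_exists[xi xiP] : forall p : X * X, exists xi : {ffun Y -> 'I_m2},
    is_char xi /\ mo (z p.1 p.2) <= mo (\avg_y (g p.2 y * (g p.1 y)^* * echar R xi y)).
  case=> x' x /=.
  have [y|n|xi chi le_xi] := fourier_large torY (fun y => g x y * (g x' y)^*)
    (_ : forall y, mo (f x y * (f x' y)^*) <= 1) (_ : forall n, mo (u n x * (u n x')^*) <= 1).
  - by apply: mo_mul_le1; rewrite ?moJ.
  - by apply: mo_mul_le1; rewrite ?moJ.
  by exists xi.
pose Z x' x := \avg_y (g x y * (g x' y)^* * echar R (xi (x', x)) y).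
(* The phases make all correlations [Z x' x] nonnegative, so that their moduli can be summed inside
   one average. *)
have /fin_all_exists[a aP] : forall p : X * X, exists a : C,
    mo a <= 1 /\ a * Z p.1 p.2 = (mo (Z p.1 p.2))%:C%C.
  by case=> x' x /=; have [a ? ?] := phase (Z x' x); exists a.
pose B x' y := \avg_x (g x y * (a (x', x) * echar R (xi (x', x)) y)).
have le_B : kappa <= mo (\avg_p (((g p.1 p.2)^*) * B p.1 p.2)).
  have -> : \avg_p (((g p.1 p.2)^*) * B p.1 p.2) = (\avg_x' \avg_x mo (Z x' x))%:C%C.
    rewrite (Ex_pair (fun x' y => (g x' y)^* * B x' y)) real_complex_avg.
    apply: eq_Ex => x'; rewrite real_complex_avg.
    under eq_Ex do rewrite -ExZl.
    rewrite Ex_swap; apply: eq_Ex => x.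
    have [_ <-] := aP (x', x); rewrite -ExZl.
    by apply: eq_Ex => y; ring.
  rewrite mo_real; last by apply: Ex_ge0 => x'; apply: Ex_ge0 => x; apply: mo_ge0.
  apply: le_trans le_z _; apply: le_Ex => x'; apply: le_Ex => x.
  by have [_] := xiP (x', x).
(* Cauchy-Schwarz over [(x', y)] removes the factor [(g x' y)^*], whose mean square is at most 1.
   Then one good [x'] can be fixed. *)
have : kappa ^+ 2 <= \avg_x' \avg_y (mo (B x' y) ^+ 2).
  rewrite -(Ex_pair (fun x' y => mo (B x' y) ^+ 2)).
  apply: (@le_trans _ _ (mo (\avg_p (((g p.1 p.2)^*) * B p.1 p.2)) ^+ 2)).
    by rewrite lerXn2r ?nnegrE ?mo_ge0 // ltW.
  apply: le_trans (mo_CauchySchwarz _ _) _.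
  rewrite ler_piMl //; first by apply: Ex_ge0 => p; apply: sqr_ge0.
  under eq_Ex do rewrite moJ.
  rewrite (Ex_pair (fun x' y => mo (g x' y) ^+ 2)) Ex_swap.
  by apply: Ex_le => // y; apply: g1.
have k20 : 0 < kappa ^+ 2 by apply: exprn_gt0.
move/(Ex_exists k20) => [x' le_x'].
exists (fun x => xi (x', x)), (fun x => a (x', x)); split=> // x; first by have [] := xiP (x', x).
by have [] := aP (x', x).
Qed.

End CharacterCorrelation.

Section Energy.
Variable R : rcfType.
Local Notation C := R[i].

Lemma real_avg_mo (T : finType) (f : T -> R) (F : C) :
  (forall x, 0 <= f x) -> (\avg_x f x)%:C%C = F -> \avg_x f x = mo F.
Proof. by move=> f0 <-; rewrite mo_real // Ex_ge0. Qed.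

Lemma le_sqr (x y : R) : 0 <= x -> x <= y -> x ^+ 2 <= y ^+ 2.
Proof. by move=> x0 lexy; rewrite lerXn2r ?nnegrE // (le_trans x0). Qed.

(** With z = x + m the left side is a pairing of [Theta] with the convolution [W] of [Psi] and [V].
    One Cauchy-Schwarz removes [Theta]; the mean square of [W] pairs the autocorrelations of [V] and
    [Psi], and a second Cauchy-Schwarz removes [V]. *)
Lemma correlation_energy (X : finZmodType) (Psi Theta V : X -> C) :
    (forall x, mo (Theta x) <= 1) -> (forall x, mo (V x) <= 1) ->
  mo (\avg_m \avg_x (Psi x * Theta (x + m) * V m)) ^+ 4
  <= \avg_d (mo (\avg_x (Psi x * (Psi (x + d))^*)) ^+ 2).
Proof.
move=> Theta1 V1; pose W z := \avg_x (Psi x * V (z - x)).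
pose A d := \avg_x (Psi x * (Psi (x + d))^*).
have -> : \avg_m \avg_x (Psi x * Theta (x + m) * V m) = \avg_z (Theta z * W z).
  rewrite Ex_swap.
  under [RHS]eq_Ex do rewrite -ExZl.
  rewrite [RHS]Ex_swap; apply: eq_Ex => x.
  rewrite -[LHS](Ex_shift (- x)); apply: eq_Ex => z.
  by rewrite [x + _]addrC subrK; ring.
have le1 : mo (\avg_z (Theta z * W z)) ^+ 2 <= \avg_z (mo (W z) ^+ 2).
  apply: le_trans (sqr_mo_avg _) _; apply: le_Ex => z.
  by rewrite moM exprMn ler_piMl ?sqr_ge0 // expr_le1 ?mo_ge0.
rewrite (exprM _ 2 2); apply: le_trans (le_sqr (sqr_ge0 _) le1) _.
rewrite (real_avg_mo (F := \avg_d ((\avg_z (V z * (V (z - d))^*)) * A d))); first last.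
- rewrite real_complex_avg.
  under eq_Ex do rewrite sqr_mo_avgE.
  under [RHS]eq_Ex do rewrite -ExZl.
  rewrite [RHS]Ex_swap Ex_swap; apply: eq_Ex => x.
  under eq_Ex => z do rewrite -(Ex_shiftl x).
  rewrite Ex_swap; apply: eq_Ex => d.
  rewrite [RHS]mulrC -ExZl -[RHS](Ex_shift (- x)) /=; apply: eq_Ex => z.
  by rewrite !rmorphM opprD addrA /=; ring.
- by move=> z; apply: sqr_ge0.
apply: le_trans (sqr_mo_avg _) _; apply: le_Ex => d.
rewrite (moM (\avg_z _)) exprMn ler_piMl ?sqr_ge0 // expr_le1 ?mo_ge0 //.
by apply: mo_avg_le1 => z; apply: mo_mul_le1; rewrite ?moJ.
Qed.

(** Schur's test: convolution with a nonnegative kernel of total mass at most 1 does not increase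
    the l2 norm. *)
Lemma schur_bound (H : finZmodType) (r K : H -> R) :
    (forall s, 0 <= K s) -> \sum_s K s <= 1 ->
  \sum_s \sum_t r s * r t * K (s - t) <= \sum_s r s ^+ 2.
Proof.
move=> K0 K1.
apply: (@le_trans _ _ (\sum_s \sum_t (r s ^+ 2 / 2 * K (s - t) + r t ^+ 2 / 2 * K (s - t)))).
  apply: ler_sum => s _; apply: ler_sum => t _; rewrite -mulrDl ler_wpM2r //.
  by have := sqr_ge0 (r s - r t); nra.
under eq_bigr do rewrite big_split /=.
rewrite big_split /= [X in _ + X]exchange_big /= -big_split /=.
apply: ler_sum => s _; rewrite -!mulr_sumr -mulrDr.
have -> : \sum_t K (s - t) = \sum_t K t.
  by rewrite [RHS](reindex_inj oppr_inj) [RHS](reindex_inj (addrI (- s))) /=;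
     apply: eq_bigr => t _; rewrite opprD opprK.
have -> : \sum_t K (t - s) = \sum_t K t.
  by rewrite (reindex_inj (addIr s)); apply: eq_bigr => t _; rewrite addrK.
have := sqr_ge0 (r s); nra.
Qed.

Section CharacterGraph.
Variables (X Y : finZmodType) (m' : nat).
Local Notation m := m'.+1.
Hypothesis torsionY : forall y : Y, y *+ m = 0.
Variables (A : {set X}) (xi : X -> {ffun Y -> 'I_m}) (b : Y -> C) (c : X -> C).
Hypotheses (xi_char : forall x, is_char (xi x)) (b1 : forall y, mo (b y) <= 1).
Hypothesis c_le : forall x, mo (c x) <= (x \in A)%:B.

Let phi x y := b y * (c x * echar R (xi x) y).

(** Averaging over y and y' turns the characters into weights [K], the squared Fourier coefficients
    of |b|^4. If |b| were 1, [K] would be the indicator of 0 and the bound would simply count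
    additive quadruples in the graph; in general Parseval bounds the mass of [K] by 1 and
    [schur_bound] gives the same estimate. *)
Lemma phi_energy :
  \avg_y \avg_y' \avg_d (mo (\avg_x (phi x y * (phi x y')^* *
       (phi (x + d) y * (phi (x + d) y')^*)^*)) ^+ 2)
  <= (\sum_z graph_diff R A xi z ^+ 2) / #|X|%:R.
Proof.
pose k d x := mo (c x) ^+ 2 * mo (c (x + d)) ^+ 2.
pose st d x := xi x - xi (x + d).
pose beta y : C := (mo (b y) ^+ 4)%:C%C.
pose K (z : {ffun Y -> 'I_m}) := mo (fourier beta z) ^+ 2.
have conjR (r : R) : (r%:C%C)^* = r%:C%C :> C by exact: conjc_real.
have mo2 (z : C) : (mo z)%:C%C * (mo z)%:C%C = z * z^*.
  by rewrite -sqr_mo rmorphXn.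
have prodE y y' d x : phi x y * (phi x y')^* * (phi (x + d) y * (phi (x + d) y')^*)^* =
    (k d x)%:C%C * (mo (b y) ^+ 2 * mo (b y') ^+ 2)%:C%C *
    (echar R (st d x) y * (echar R (st d x) y')^*).
  rewrite /phi /k /st !echarD -!echar_conj !rmorphM /= !mo2 !conjCK.
  by ring.
have -> : \avg_y \avg_y' \avg_d (mo (\avg_x (phi x y * (phi x y')^* *
       (phi (x + d) y * (phi (x + d) y')^*)^*)) ^+ 2) =
  \avg_d \avg_x \avg_x' (k d x * k d x' * K (st d x - st d x')).
  apply: complexI; rewrite !real_complex_avg.
  under eq_Ex => y do rewrite real_complex_avg.
  under eq_Ex => y do under eq_Ex => y' do rewrite real_complex_avg.
  under eq_Ex => y do rewrite Ex_swap.
  rewrite Ex_swap; apply: eq_Ex => d; rewrite real_complex_avg.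
  under eq_Ex => y do under eq_Ex => y' do rewrite sqr_mo_avgE.
  under eq_Ex => y do rewrite Ex_swap.
  rewrite Ex_swap; apply: eq_Ex => x; rewrite real_complex_avg.
  under eq_Ex => y do rewrite Ex_swap.
  rewrite Ex_swap; apply: eq_Ex => x'.
  rewrite rmorphM /= sqr_mo /fourier conj_avg Ex_mul -ExZl; apply: eq_Ex => y.
  rewrite -ExZl; apply: eq_Ex => y'.
  rewrite !prodE !echarD -!echar_conj /st !echarD -!echar_conj.
  rewrite !rmorphM /= !conjR !conjCK /beta !rmorphXn /=.
  by ring.
pose I d x : R := ((x \in A) && (x + d \in A))%:B.
(* Parseval sums over characters only, but [schur_bound] sums over all functions to Z/m. *)
pose K' z := if is_char z then K z else 0.
have K'0 z : 0 <= K' z by rewrite /K'; case: ifP => // _; apply: sqr_ge0.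
have sumK' : \sum_z K' z <= 1.
  rewrite -big_mkcond (parseval torsionY beta); apply: Ex_le => // y.
  by rewrite expr_le1 ?mo_ge0 // mo_real ?exprn_ge0 ?mo_ge0 // expr_le1 ?mo_ge0.
have k_ge0 d x : 0 <= k d x by rewrite mulr_ge0 ?sqr_ge0.
have leI d x : k d x <= I d x.
  rewrite /I indicM /k; apply: ler_pM; rewrite ?sqr_ge0 //.
    apply: le_trans (le_sqr (mo_ge0 _) (c_le x)) _.
    by case: (x \in A); rewrite ?expr1n ?expr0n.
  apply: le_trans (le_sqr (mo_ge0 _) (c_le (x + d))) _.
  by case: (x + d \in A); rewrite ?expr1n ?expr0n.
apply: (@le_trans _ _ (\avg_d \avg_x \avg_x' (I d x * I d x' * K' (st d x - st d x')))).
  apply: le_Ex => d; apply: le_Ex => x; apply: le_Ex => x'.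
  have -> : K (st d x - st d x') = K' (st d x - st d x').
    by rewrite /K' /st !is_charD ?is_charN ?is_charD ?is_charN.
  rewrite ler_wpM2r //; apply: ler_pM => //.
have -> : (\sum_z graph_diff R A xi z ^+ 2) / #|X|%:R = \avg_d \sum_s graph_diff R A xi (d, s) ^+ 2.
  by rewrite /Ex pair_bigA; congr (_ / _); apply: eq_bigr => -[].
apply: le_Ex => d.
apply: le_trans (schur_bound (fun s => graph_diff R A xi (d, s)) K'0 sumK').
rewrite le_eqVlt; apply/orP; left; apply/eqP.
have gdE s : graph_diff R A xi (d, s) = \avg_x (I d x * (st d x == s)%:B).
  apply: eq_Ex => x; rewrite /I -indicM -andbA; congr (_%:R); congr (nat_of_bool [&& _, _ & _]).
  rewrite /st /graph_pt /= [RHS](_ : _ = ((x + d, - xi (x + d)) - (x, - xi x) == (d, s))) //.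
  have -> : (x + d, - xi (x + d)) - (x, - xi x) = (d, xi x - xi (x + d)).
    by congr (_, _) => /=; rewrite ?opprK; [rewrite addrAC subrr add0r | rewrite addrC].
  by rewrite xpair_eqE eqxx.
under [RHS]eq_bigr => s _ do under eq_bigr => t _ do rewrite !gdE Ex_mul -ExZr.
under [RHS]eq_bigr do rewrite -Ex_sum.
rewrite -Ex_sum; apply: eq_Ex => x.
under [RHS]eq_bigr do under eq_bigr do rewrite -ExZr.
under [RHS]eq_bigr do rewrite -Ex_sum.
rewrite -Ex_sum; apply: eq_Ex => x'.
rewrite (bigD1 (st d x)) //= [X in _ = _ + X]big1 ?addr0 => [|s /negPf ns]; last first.
  by rewrite big1 // => t _; rewrite eq_sym ns mulr0 !mul0r.
rewrite (bigD1 (st d x')) //= [X in _ = _ + X]big1 ?addr0 => [|s /negPf ns]; last first.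
  by rewrite [st d x' == s]eq_sym ns !mulr0 !mul0r.
by rewrite !eqxx !mulr1.
Qed.

End CharacterGraph.
End Energy.

Section Popularity.
Variable R : rcfType.
Local Notation C := R[i].
Variables (m1 m2' s : nat).
Local Notation m2 := m2'.+1.
Hypothesis coprime_m : coprime m1 m2.
Hypothesis IH : product_detects R m1 m2 s.

(** After a shift in [X] alone and the induction hypothesis, Cauchy-Schwarz in (m, x) removes
    [u m x] and doubles y. Apart from [Psi], the remaining factors depend only on x + m or only on
    m, so [correlation_energy] discards them, and [phi_energy] bounds what is left by the energy of
    the graph. *)
Lemma structured_popular delta : 0 < delta -> exists2 p : R, 0 < p &
  forall X Y : finZmodType,
    (forall x : X, x *+ m1 = 0) -> (forall y : Y, y *+ m2 = 0) ->
  forall (F : X * Y -> C) (A : {set X}) (xi : X -> {ffun Y -> 'I_m2})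
    (b : Y -> C) (c : X -> C),
    isdual s.+1 F -> (forall x, is_char (xi x)) -> (forall y, mo (b y) <= 1) ->
    (forall x, mo (c x) <= (x \in A)%:B) ->
    delta <= mo (pairing (fun x y => b y * (c x * echar R (xi x) y)) F) ->
  exists t, p <= \avg_x ((x \in A) && (xi x == t))%:B.
Proof.
move=> delta0; have [kappa k0 family] := detected_family IH delta0.
(* [N] is 0 modulo [m1] and 1 modulo [m2], so multiplication by [N] kills [X] and fixes the
   characters of [Y]. In [tau], the eighth power of [kappa], one squaring is the Cauchy-Schwarz that
   doubles y and the fourth power is that of [correlation_energy]. *)
pose N := chinese m1 m2 0 1.
pose tau := ((kappa ^+ 2) ^+ 2) ^+ 2.
have tau0 : 0 < tau by rewrite !exprn_gt0.
exists (popularity tau N); first exact: popularity_gt0.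
move=> X Y torX torY F A xi b c dualF xi_char b1 c_le le_delta.
apply: graph_energy_popular tau0 _ _ _.
- move=> x; have /dvdnP[q ->] : (m1 %| N)%N.
    by rewrite /dvdn /N chinese_modl // mod0n.
  by rewrite mulnC mulrnA torX mul0rn.
- move=> h; apply/ffunP => y; rewrite ffunMnE Zp_mulrn; apply: val_inj.
  by rewrite /= -modnMmr /N chinese_modr // modnMmr muln1 modn_small.
set phi := fun x y => b y * (c x * echar R (xi x) y) in le_delta *.
have phi1 x y : mo (phi x y) <= 1.
  apply: mo_mul_le1 => //; rewrite moM mo_echar mulr1.
  by apply: le_trans (c_le x) _; apply: indic_le1.
have [f [D [f1 dualD le_shift]]] := shift_left delta0 dualF le_delta.
have [m|u u1 le_k] := family X Y torX torY X _ D _ dualD le_shift.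
  by apply: bounded_column_bounded => x y; apply: mo_mul_le1.
pose B m y := \avg_x (phi x y * f (x + m) y * u m x).
have B1 m y : mo (B m y) <= 1.
  by apply: mo_avg_le1 => x; do 2?apply: mo_mul_le1.
pose W m x := \avg_y (phi x y * f (x + m) y * (B m y)^*).
have le_W : kappa <= \avg_m \avg_x mo (W m x).
  apply: (@le_trans _ _ (mo (\avg_m \avg_x (u m x * W m x)))); last first.
    apply: le_trans (mo_avg _) _; apply: le_Ex => m.
    apply: le_trans (mo_avg _) _; apply: le_Ex => x.
    by rewrite (moM (u m x)) ler_piMl ?mo_ge0.
  apply: le_trans le_k _; rewrite le_eqVlt; apply/orP; left; apply/eqP.
  apply: real_avg_mo => [m|]; first by apply: Ex_ge0 => y; apply: sqr_ge0.
  rewrite real_complex_avg; apply: eq_Ex => m; rewrite real_complex_avg.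
  under [RHS]eq_Ex do rewrite -ExZl.
  rewrite [RHS]Ex_swap; apply: eq_Ex => y.
  rewrite sqr_mo -/(B m y) {1}/B -ExZr; apply: eq_Ex => x.
  by ring.
pose Psi y y' x := phi x y * (phi x y')^*.
pose Q y y' := \avg_m \avg_x (Psi y y' x *
  (f (x + m) y * (f (x + m) y')^*) * ((B m y)^* * B m y')).
have le_Q : kappa ^+ 2 <= \avg_p mo (Q p.1 p.2).
  rewrite (Ex_pair (fun y y' => mo (Q y y'))).
  apply: (@le_trans _ _ (\avg_m \avg_x (mo (W m x) ^+ 2))).
    rewrite -(Ex_pair (fun m x => mo (W m x) ^+ 2)); apply: le_sqr_avg; first exact: ltW.
    by rewrite (Ex_pair (fun m x => mo (W m x))).
  apply: (@le_trans _ _ (mo (\avg_y \avg_y' Q y y'))); last first.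
    by apply: le_trans (mo_avg _) _; apply: le_Ex => y; apply: mo_avg.
  rewrite le_eqVlt; apply/orP; left; apply/eqP.
  apply: real_avg_mo => [m|]; first by apply: Ex_ge0 => y; apply: sqr_ge0.
  rewrite real_complex_avg; under eq_Ex do rewrite real_complex_avg.
  under eq_Ex => m do under eq_Ex => x do rewrite sqr_mo_avgE.
  under [RHS]eq_Ex do rewrite Ex_swap.
  rewrite [RHS]Ex_swap; apply: eq_Ex => m.
  under [RHS]eq_Ex do rewrite Ex_swap.
  rewrite [RHS]Ex_swap; apply: eq_Ex => x.
  apply: eq_Ex => y; apply: eq_Ex => y'.
  by rewrite /Psi; move: (B m y) (B m y') => z z'; rewrite !rmorphM /= conjCK; ring.
have k20 : 0 <= kappa ^+ 2 by apply: sqr_ge0.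
apply: le_trans (le_sqr_avg (sqr_ge0 _) (le_sqr_avg k20 le_Q)) _.
rewrite (Ex_pair (fun y y' => (mo (Q y y') ^+ 2) ^+ 2)).
apply: le_trans (phi_energy torY xi_char b1 c_le).
apply: le_Ex => y; apply: le_Ex => y'; rewrite -exprM.
apply: (@correlation_energy R X (Psi y y') (fun z => f z y * (f z y')^*)
          (fun m => (B m y)^* * B m y')) => [z|m]; by apply: mo_mul_le1; rewrite ?moJ.
Qed.

End Popularity.

Section Projection.
Variable R : rcfType.
Local Notation C := R[i].

Lemma sqr_mo_sum (I : finType) (P : pred I) (z : I -> C) :
  mo (\sum_(i | P i) z i) ^+ 2 <= #|P|%:R * \sum_(i | P i) mo (z i) ^+ 2.
Proof.
apply: le_trans (le_sqr (mo_ge0 _) (mo_sum _ _ _)) _.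
set S := \sum_(i | P i) mo (z i); set T := \sum_(i | P i) _.
have : 0 <= \sum_(i | P i) \sum_(j | P j) (mo (z i) - mo (z j)) ^+ 2.
  by apply: sumr_ge0 => i _; apply: sumr_ge0 => j _; apply: sqr_ge0.
have -> : \sum_(i | P i) \sum_(j | P j) (mo (z i) - mo (z j)) ^+ 2 =
    \sum_(i | P i) (#|P|%:R * mo (z i) ^+ 2 + T - 2 * mo (z i) * S).
  apply: eq_bigr => i _; rewrite /S mulr_sumr /T -sumrN.
  have -> : #|P|%:R * mo (z i) ^+ 2 = \sum_(j | P j) mo (z i) ^+ 2.
    by rewrite sumr_const mulr_natl.
  by rewrite -!big_split /=; apply: eq_bigr => j _; ring.
rewrite !big_split /= -mulr_sumr -/T sumr_const sumrN -mulr_suml -mulr_sumr -/S -[T *+ _]mulr_natl.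
by rewrite expr2; lra.
Qed.

(** With b the coefficient, expanding gives E|g|^2 - 2|b|^2 + |b|^2 E|e|^2. This is Pythagoras when
    |e| = 1, and |e| at most 1 suffices for the inequality. *)
Lemma avg_sqr_projection (X : finType) (g e : X -> C) :
    (forall x, mo (e x) <= 1) ->
  \avg_x (mo (g x - (\avg_x (g x * e x)) * (e x)^*) ^+ 2)
  <= \avg_x (mo (g x) ^+ 2) - mo (\avg_x (g x * e x)) ^+ 2.
Proof.
move=> e1; set b := \avg_x (g x * e x).
have -> : \avg_x (mo (g x - b * (e x)^*) ^+ 2) =
    \avg_x (mo (g x) ^+ 2) - 2 * mo b ^+ 2 + mo b ^+ 2 * \avg_x (mo (e x) ^+ 2).
  apply: complexI; rewrite rmorphD rmorphB /= (rmorphM _ 2) (rmorphM _ (mo b ^+ 2)) /=.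
  rewrite !real_complex_avg.
  under eq_Ex do rewrite sqr_mo rmorphB rmorphM /= conjCK.
  transitivity (\avg_x (g x * (g x)^* - b^* * (g x * e x) - b * (g x * e x)^* +
      b * b^* * (e x * (e x)^*))).
    by apply: eq_Ex => x; rewrite !rmorphM /=; ring.
  rewrite ExD !ExB !ExZl -conj_avg -/b.
  under [in RHS]eq_Ex do rewrite sqr_mo.
  under [X in _ + _ * X = _]eq_Ex do rewrite -sqr_mo.
  by rewrite [b^* * b]mulrC -!sqr_mo rmorph_nat; ring.
have : \avg_x (mo (e x) ^+ 2) <= 1.
  by apply: Ex_le => // x; rewrite expr_le1 ?mo_ge0.
have := sqr_ge0 (mo b); nra.
Qed.

Section Columns.
Variables X Y : finZmodType.
Implicit Types (g e : X -> Y -> C) (F : X * Y -> C).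

Definition column_part g e (y : Y) : C := \avg_x (g x y * e x y).

Definition column_residue g e x y : C := g x y - column_part g e y * (e x y)^*.

Lemma column_part_le1 g e y : column_bounded g -> (forall x y, mo (e x y) <= 1) ->
  mo (column_part g e y) <= 1.
Proof.
move=> g1 e1; rewrite -(@expr_le1 _ 2) ?mo_ge0 //; apply: le_trans (sqr_mo_avg _) _.
exact: (column_bounded_mul g1 e1 y).
Qed.

Lemma column_residue_bounded g e : column_bounded g ->
  (forall x y, mo (e x y) <= 1) -> column_bounded (column_residue g e).
Proof.
move=> g1 e1 y; apply: le_trans (avg_sqr_projection (g^~ y) (e1^~ y)) _.
by apply: le_trans (g1 y); rewrite gerBl sqr_ge0.
Qed.

Lemma column_residue_energy g e : (forall x y, mo (e x y) <= 1) ->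
  \avg_y \avg_x (mo (column_residue g e x y) ^+ 2) <=
  \avg_y \avg_x (mo (g x y) ^+ 2) - \avg_y (mo (column_part g e y) ^+ 2).
Proof.
move=> e1; rewrite -ExB; apply: le_Ex => y.
exact: (avg_sqr_projection (g^~ y) (e1^~ y)).
Qed.

Lemma pairing_residue g e F : pairing (column_residue g e) F =
  pairing g F - pairing (fun x y => column_part g e y * (e x y)^*) F.
Proof.
rewrite /pairing -ExB; apply: eq_Ex => x; rewrite -ExB; apply: eq_Ex => y.
by rewrite mulrBl.
Qed.

Lemma sqr_mo_pairing g F : (forall p, mo (F p) <= 1) ->
  mo (pairing g F) ^+ 2 <= \avg_y \avg_x (mo (g x y) ^+ 2).
Proof.
move=> F1; rewrite Ex_swap; apply: le_trans (sqr_mo_avg _) _; apply: le_Ex => x.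
apply: le_trans (sqr_mo_avg _) _; apply: le_Ex => y.
by rewrite moM exprMn ler_piMr ?sqr_ge0 // expr_le1 ?mo_ge0.
Qed.

End Columns.

(** Expand the square: by orthogonality only pairs x, x' with [xi x = xi x'] survive, and each x in
    [A] has at most a proportion [p] of such partners. *)
Lemma nonpopular_small (X Y : finZmodType) (m' : nat) (A : {set X})
    (xi : X -> {ffun Y -> 'I_m'.+1}) (k : X -> C) (p : R) :
    0 <= p -> (forall x, is_char (xi x)) -> (forall x, mo (k x) <= (x \in A)%:B) ->
    (forall x, x \in A -> \avg_z (xi z == xi x)%:B <= p) ->
  \avg_y (mo (\avg_x (k x * echar R (xi x) y)) ^+ 2) <= p.
Proof.
move=> p0 xi_char kA popA.
rewrite (real_avg_mo (F := \avg_x \avg_x' (k x * (k x')^* * (xi x' == xi x)%:B))); first last.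
- rewrite real_complex_avg; under eq_Ex do rewrite sqr_mo_avgE.
  rewrite Ex_swap; apply: eq_Ex => x; rewrite Ex_swap; apply: eq_Ex => x'.
  rewrite [xi x' == _]eq_sym -subr_eq0 -(avg_char R) ?is_charD ?is_charN // -ExZl.
  by apply: eq_Ex => y; rewrite echarD -echar_conj rmorphM /=; ring.
- by move=> y; apply: sqr_ge0.
apply: le_trans (mo_avg _) _; apply: Ex_le => // x; apply: le_trans (mo_avg _) _.
have mo_indic (b : bool) : mo (b%:B : C) = b%:B by case: b; rewrite ?mo0 ?mo1.
have k1 z : mo (k z) <= 1 by apply: le_trans (kA z) (indic_le1 _ _).
apply: (@le_trans _ _ (\avg_x' ((x \in A)%:B * (xi x' == xi x)%:B))).
  apply: le_Ex => x'; rewrite (moM (k x * _)) (moM (k x)) mo_indic moJ ler_wpM2r ?indic_ge0 //.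
  by rewrite -[leRHS]mulr1; apply: ler_pM; rewrite ?mo_ge0.
rewrite ExZl; case: (boolP (x \in A)) => [/popA|_]; first by rewrite mul1r.
by rewrite mul0r.
Qed.

Lemma detected_subtract (X Y : finZmodType) (g e : X -> Y -> C) (eta p : R) :
    column_bounded g -> (forall x y, mo (e x y) <= 1) ->
    detected (column_residue g e) eta ->
    (forall u : X -> C, (forall x, mo (u x) <= 1) ->
       \avg_y (mo (\avg_x ((e x y)^* * u x)) ^+ 2) <= p) ->
  detected g (eta / 2 - p).
Proof.
move=> g1 e1 [u u1 le_eta] small; exists u => //.
have : \avg_y (mo (\avg_x (column_residue g e x y * u x)) ^+ 2) <=
   2 * \avg_y (mo (\avg_x (g x y * u x)) ^+ 2) + 2 * \avg_y (mo (\avg_x ((e x y)^* * u x)) ^+ 2).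
  rewrite -!ExZl -ExD; apply: le_Ex => y.
  have -> : \avg_x (column_residue g e x y * u x) =
     \avg_x (g x y * u x) + (- column_part g e y) * \avg_x ((e x y)^* * u x).
    by rewrite -ExZl -ExD; apply: eq_Ex => x; rewrite /column_residue; ring.
  apply: le_trans (sqr_moD _ _) _; rewrite lerD2l ler_pM2l //.
  rewrite (moM (- _)) exprMn moN ler_piMl ?sqr_ge0 // expr_le1 ?mo_ge0 //.
  exact: column_part_le1.
by have := small u u1; lra.
Qed.

(** There are at most 1/p popular values, their level sets being disjoint. On a level set the
    character depends on y alone, so it vanishes under the modulus; Cauchy-Schwarz over the values
    leaves one [t] that does the job. *)
Lemma popular_detected (X Y : finZmodType) (m' : nat) (g : X -> Y -> C)
    (xi : X -> {ffun Y -> 'I_m'.+1}) (a : X -> C) (p theta : R) :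
    0 < p -> 0 < theta -> (forall x, mo (a x) <= 1) ->
    theta <= \avg_y (mo (\avg_x (g x y *
      ((p <= \avg_z (xi z == xi x)%:B)%R%:B * a x * echar R (xi x) y))) ^+ 2) ->
  detected g (p ^+ 2 * (theta / 2)).
Proof.
move=> p0 theta0 a1 le_theta; pose pop t : R := \avg_z (xi z == t)%:B.
pose P t := p <= pop t.
have cardP : #|P|%:R * p <= 1.
  apply: (@le_trans _ _ (\sum_(t | P t) pop t)).
    by rewrite mulr_natl -sumr_const; apply: ler_sum.
  rewrite -Ex_sum; apply: Ex_le => // z; rewrite big_mkcond (bigD1 (xi z)) //=.
  rewrite big1 ?addr0 => [|t tz]; first by case: ifP => _; rewrite ?indic_le1.
  by rewrite eq_sym (negPf tz) if_same.
pose part t y := \avg_x (g x y * (a x * (xi x == t)%:B)).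
have le_sum : theta <= #|P|%:R * \sum_(t | P t) \avg_y (mo (part t y) ^+ 2).
  apply: le_trans le_theta _; rewrite -Ex_sum -ExZl; apply: le_Ex => y.
  have -> : \avg_x (g x y * ((P (xi x))%:B * a x * echar R (xi x) y)) =
      \sum_(t | P t) part t y * echar R t y.
    under [RHS]eq_bigr do rewrite -ExZr.
    rewrite -Ex_sum; apply: eq_Ex => x; rewrite big_mkcond (bigD1 (xi x)) //= big1 ?addr0.
      by rewrite eqxx; case: (P (xi x)) => /=; ring.
    by move=> t tx; rewrite eq_sym (negPf tx) !mulr0 mul0r if_same.
  apply: le_trans (sqr_mo_sum _ _) _; rewrite ler_wpM2l ?ler0n //.
  by apply: ler_sum => t _; rewrite moM mo_echar mulr1.
have [t le_t|noP] := pickP (fun t => P t && (p ^+ 2 * (theta / 2) <= \avg_y (mo (part t y) ^+ 2))).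
  case/andP: le_t => _ le_t; exists (fun x => a x * (xi x == t)%:B) => // x.
  by apply: mo_mul_le1 => //; case: (_ == _); rewrite ?mo0 ?mo1.
have : #|P|%:R * \sum_(t | P t) \avg_y (mo (part t y) ^+ 2) <=
       #|P|%:R * (#|P|%:R * (p ^+ 2 * (theta / 2))).
  rewrite ler_wpM2l ?ler0n // [leRHS]mulr_natl -sumr_const; apply: ler_sum => t Pt.
  by have := noP t; rewrite Pt /= => /negbT; rewrite -ltNge => /ltW.
have : (#|P|%:R * p) ^+ 2 <= 1 by rewrite expr_le1 ?mulr_ge0 ?ler0n // ltW.
have -> : #|P|%:R * (#|P|%:R * (p ^+ 2 * (theta / 2))) = (#|P|%:R * p) ^+ 2 * (theta / 2) by ring.
by move: (_ ^+ 2) => q; nra.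
Qed.

End Projection.

Section InductionStep.
Variable R : archiRcfType.
Local Notation C := R[i].
Variables (m1 m2' s : nat).
Local Notation m2 := m2'.+1.
Hypothesis coprime_m : coprime m1 m2.
Hypothesis IH : product_detects R m1 m2 s.

Lemma detected_le (X Y : finZmodType) (g : X -> Y -> C) (eta eta' : R) :
  eta' <= eta -> detected g eta -> detected g eta'.
Proof. by move=> le_eta [u u1 le_u]; exists u => //; apply: le_trans le_u. Qed.

(* Subtract from [g] the part correlating with [a x * xi_x y], restricted to those *)
(* [x] whose [xi_x] is rare: the pairing hardly changes, the energy drops, and     *)
(* functions [u x * v y] hardly see the difference.                                *)
Lemma product_detects_step : product_detects R m1 m2 s.+1.
Proof.
move=> nu nu0; have nu20 : 0 < nu / 2 by rewrite divr_gt0.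
have [c c0 correlate] := character_correlation IH nu20.
pose J := (Num.truncn (4 / c)).+1.
have J0 : 0 < J%:R :> R by rewrite ltr0n.
have J4 : 1 <= J%:R * (c / 4).
  have : 4 / c < J%:R by apply: truncnS_gt.
  by rewrite ltr_pdivrMr // mulrA ler_pdivlMr // mul1r => /ltW.
pose delta := nu / 2 / J%:R; have delta0 : 0 < delta by rewrite divr_gt0.
have [p0 p00 popular] := structured_popular coprime_m IH delta0.
have c40 : 0 < c / 4 by rewrite divr_gt0.
(* Here [j] bounds the remaining energy in units of [c / 4], and each step may spend [delta] of the
   pairing. The case [j = 0] is vacuous: zero energy contradicts a pairing of at least [nu / 2]. At
   [j = J] the energy bound is at least 1 and the pairing bound is [nu]. *)
have rec j : exists2 eta : R, 0 < eta & forall X Y : finZmodType,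
    (forall x : X, x *+ m1 = 0) -> (forall y : Y, y *+ m2 = 0) ->
    forall (F : X * Y -> C) (g : X -> Y -> C), isdual s.+1 F -> column_bounded g ->
    \avg_y \avg_x (mo (g x y) ^+ 2) <= j%:R * (c / 4) ->
    nu / 2 + delta * j%:R <= mo (pairing g F) -> detected g eta.
  elim: j => [|j [eta eta0 IHj]].
    exists 1 => // X Y _ _ F g dualF g1; rewrite mul0r mulr0 addr0 => energy le_nu.
    have := sqr_mo_pairing g (fun p => isdual_le1 p dualF).
    have := le_sqr (ltW nu20) le_nu; have : 0 < (nu / 2) ^+ 2 by apply: exprn_gt0.
    by move=> h1 h2 h3; move: (le_lt_trans (le_trans h2 (le_trans h3 energy)) h1); rewrite ltxx.
  (* [p <= p0] makes values popular for [structured_popular] non-rare; [p <= eta / 4] leaves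
     [eta / 2 - p >= eta / 4] in [detected_subtract]. *)
  pose p := Num.min p0 (eta / 4).
  have p_gt0 : 0 < p by rewrite lt_min p00 divr_gt0.
  have c80 : 0 < p ^+ 2 * (c / 4 / 2).
    by apply: mulr_gt0; [exact: exprn_gt0 | exact: divr_gt0].
  exists (Num.min (eta / 4) (p ^+ 2 * (c / 4 / 2))).
    by rewrite lt_min c80 divr_gt0.
  move=> X Y torX torY F g dualF g1 energy le_nu.
  have le_nu2 : nu / 2 <= mo (pairing g F).
    by apply: le_trans le_nu; rewrite lerDl mulr_ge0 // ltW.
  have [xi [a [xi_char a1 le_c]]] := correlate X Y torX torY F g dualF g1 le_nu2.
  pose A := [set x | ~~ (p <= \avg_z (xi z == xi x)%:B)].
  pose k x := (x \in A)%:B * a x.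
  pose e x y := k x * echar R (xi x) y.
  have kA x : mo (k x) <= (x \in A)%:B.
    by rewrite /k; case: (x \in A); rewrite ?mul1r ?mul0r ?mo0.
  have e1 x y : mo (e x y) <= 1.
    by rewrite moM mo_echar mulr1; apply: le_trans (kA x) (indic_le1 _ _).
  have [big|/ltW small] := leP (c / 4) (\avg_y (mo (\avg_x (g x y *
      ((p <= \avg_z (xi z == xi x)%:B)%R%:B * a x * echar R (xi x) y))) ^+ 2)).
    apply: detected_le (popular_detected p_gt0 c40 a1 big).
    by rewrite ge_min lexx orbT.
  have part : c / 4 <= \avg_y (mo (column_part g e y) ^+ 2).
    suff : c <= 2 * (c / 4) + 2 * \avg_y (mo (column_part g e y) ^+ 2).
      by move: (\avg_y _) => t h; clear - h IH coprime_m; lra.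
    apply: le_trans le_c _; apply: le_trans (_ : _ <= 2 * (\avg_y (mo (\avg_x (g x y *
      ((p <= \avg_z (xi z == xi x)%:B)%R%:B * a x * echar R (xi x) y))) ^+ 2)) +
      2 * \avg_y (mo (column_part g e y) ^+ 2)) _; last by rewrite lerD2r ler_pM2l.
    rewrite -!ExZl -ExD; apply: le_Ex => y; apply: le_trans (sqr_moD _ _).
    rewrite -ExD le_eqVlt; apply/orP; left; apply/eqP; congr (mo _ ^+ 2).
    apply: eq_Ex => x; rewrite /e /k inE; case: (p <= _) => /=; ring.
  have residue : detected (column_residue g e) eta.
    apply: (IHj X Y torX torY F) => //; first exact: column_residue_bounded.
      apply: le_trans (column_residue_energy g e1) _.
      move: energy part; rewrite -[j.+1%:R]natr1.
      by move: (\avg_y _) (\avg_y _) => t t' h h'; clear - h h' IH coprime_m; lra.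
    (* Otherwise [structured_popular] finds a character that is popular within [A], where all
       characters are rare. It is applied to [- xi] because [e] is conjugated. *)
    have lt_delta : mo (pairing (fun x y => column_part g e y * (e x y)^*) F) < delta.
      rewrite ltNge; apply/negP => le_delta.
      have [|||||t le_t] := popular X Y torX torY F A (fun x => - xi x)
          (column_part g e) (fun x => (k x)^*).
      - exact: dualF.
      - by move=> x; rewrite is_charN.
      - by move=> y; apply: column_part_le1.
      - by move=> x; rewrite moJ.
      - apply: le_trans le_delta _; rewrite le_eqVlt; apply/orP; left; apply/eqP.
        congr (mo _); apply: eq_Ex => x; apply: eq_Ex => y.
        by rewrite /e rmorphM /= echar_conj.
      have [x0] := Ex_exists p00 le_t.
      case: (boolP ((x0 \in A) && (- xi x0 == t))) => [|_ /=]; last by rewrite leNgt p00.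
      case/andP=> x0A /eqP xi0 _; move: x0A; rewrite inE => /negP; apply.
      apply: (@le_trans _ _ p0); first by rewrite ge_min lexx.
      apply: le_trans le_t _; apply: le_Ex => x; rewrite ler_nat -xi0 eqr_opp.
      by case: (x \in A).
    rewrite pairing_residue; set q := pairing g F in le_nu *; set r := pairing _ F in lt_delta *.
    have : mo q <= mo (q - r) + mo r by rewrite -{1}(subrK r q) moD.
    move: le_nu lt_delta; rewrite -[j.+1%:R]natr1 mulrDr mulr1.
    by move=> h1 h2 h3; clear - h1 h2 h3 IH coprime_m; lra.
  apply: detected_le (detected_subtract g1 e1 residue (p := p) _).
    rewrite ge_min; apply/orP; left.
    have h : p <= eta / 4 by rewrite ge_min lexx orbT.
    by clear - h IH coprime_m; lra.
  move=> u u1; under eq_Ex => y.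
    under eq_Ex => x do rewrite /e rmorphM /= echar_conj mulrAC.
    over.
  apply: (nonpopular_small (A := A)) => [|x|x|x]; first exact: ltW.
  - by rewrite is_charN.
  - by rewrite moM moJ -[leRHS]mulr1; apply: ler_pM; rewrite ?mo_ge0.
  rewrite inE -ltNge => /ltW; apply: le_trans; apply: le_Ex => z.
  by rewrite eqr_opp.
have [eta eta0 H] := rec J.
exists eta => // X Y torX torY F g dualF g1 le_nu; apply: (H X Y torX torY F) => //.
  by apply: le_trans J4; apply: Ex_le => // y; apply: g1.
by rewrite /delta divfK ?gt_eqF // -splitr.
Qed.

End InductionStep.

Lemma product_detects_all (R : archiRcfType) m1 m2' s :
  coprime m1 m2'.+1 -> product_detects R m1 m2'.+1 s.
Proof.
move=> co; elim: s => [|s IHs]; first exact: product_detects0.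
exact: product_detects_step.
Qed.

(** * Products of several groups *)

Section Slices.
Variable R : archiRcfType.
Local Notation C := R[i].

(** The [X] component of the shift survives as an extra average, absorbed into the index type [W];
    this is what [W] in [isdual] is for. *)
Lemma isdual_slice (X Y : finZmodType) s (F : X * Y -> C) x :
  isdual s F -> isdual s (fun y => F (x, y)).
Proof.
elim: s F => [|s IHs] F /=; first by case=> c c1 Fc; exists c.
case=> W [f [D [f1 dualD defF]]].
exists (W * X)%type, (fun p y => f p.1 (x + p.2, y)), (fun p b y => D p.1 (p.2, b) (x, y)).
split=> [p y|p b|y]; [exact: f1 | exact: IHs |].
rewrite defF (Ex_pair (fun w a => \avg_b (f w (x + a, y + b) * D w (a, b) (x, y)))).
apply: eq_Ex => w.
rewrite -(Ex_pair (fun a b => f w (x + a, y + b) * D w (a, b) (x, y))).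
by apply: eq_Ex => -[a b].
Qed.

Lemma isdual_bij (G G' : finZmodType) (q : G' -> G) s (F : G -> C) :
  bijective q -> {morph q : x y / x + y} -> isdual s F -> isdual s (F \o q).
Proof.
move=> bijq qD; elim: s F => [|s IHs] F /=; first by case=> c c1 Fc; exists c => // x /=.
case=> W [f [D [f1 dualD defF]]].
exists W, (fun w x => f w (q x)), (fun w h x => D w (q h) (q x)).
split=> // [w h|x]; first exact: IHs.
rewrite /= defF; apply: eq_Ex => w; rewrite -(Ex_bij _ bijq).
by apply: eq_Ex => h; rewrite qD.
Qed.

(* Iterating [product_detects] decomposes [g] into few functions [u x * v y], each *)
(* [v] being a combination of averages [E_x g x y * u x], plus a residue that      *)
(* pairs weakly with [F].                                                          *)
Lemma product_detects_slice m1 m2 s : product_detects R m1 m2 s ->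
  forall nu : R, 0 < nu -> exists2 rho : R, 0 < rho &
    forall X Y : finZmodType,
      (forall x : X, x *+ m1 = 0) -> (forall y : Y, y *+ m2 = 0) ->
    forall (F : X * Y -> C) (g : X -> Y -> C), isdual s F -> column_bounded g ->
      nu <= mo (pairing g F) ->
    exists (u : X -> C) (x : X), (forall x', mo (u x') <= 1) /\
      rho <= mo (\avg_y ((\avg_x' (g x' y * u x')) * F (x, y))).
Proof.
move=> detect nu nu0; have nu20 : 0 < nu / 2 by rewrite divr_gt0.
have [eta eta0 detect_nu] := detect _ nu20.
pose J := (Num.truncn eta^-1).+1.
have J0 : 0 < J%:R :> R by rewrite ltr0n.
have J4 : 1 <= J%:R * eta.
  have : eta^-1 < J%:R by apply: truncnS_gt.
  by rewrite -[eta^-1]mul1r ltr_pdivrMr // => /ltW.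
pose delta := nu / 2 / J%:R; have delta0 : 0 < delta by rewrite divr_gt0.
have rec j : exists2 rho : R, 0 < rho & forall X Y : finZmodType,
    (forall x : X, x *+ m1 = 0) -> (forall y : Y, y *+ m2 = 0) ->
    forall (F : X * Y -> C) (g : X -> Y -> C), isdual s F -> column_bounded g ->
    \avg_y \avg_x (mo (g x y) ^+ 2) <= j%:R * eta ->
    nu / 2 + delta * j%:R <= mo (pairing g F) ->
    exists (u : X -> C) (x : X), (forall x', mo (u x') <= 1) /\
      rho <= mo (\avg_y ((\avg_x' (g x' y * u x')) * F (x, y))).
  elim: j => [|j [rho rho0 IHj]].
    exists 1 => // X Y _ _ F g dualF g1; rewrite mul0r mulr0 addr0 => energy le_nu.
    have := sqr_mo_pairing g (fun p => isdual_le1 p dualF).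
    have := le_sqr (ltW nu20) le_nu; have : 0 < (nu / 2) ^+ 2 by apply: exprn_gt0.
    by move=> h1 h2 h3; move: (le_lt_trans (le_trans h2 (le_trans h3 energy)) h1); rewrite ltxx.
  exists (Num.min delta (rho / 2)); first by rewrite lt_min delta0 divr_gt0.
  move=> X Y torX torY F g dualF g1 energy le_nu.
  have le_nu2 : nu / 2 <= mo (pairing g F).
    by apply: le_trans le_nu; rewrite lerDl mulr_ge0 // ltW.
  have [u u1 le_eta] := detect_nu X Y torX torY F g dualF g1 le_nu2.
  pose e (x : X) (y : Y) := u x.
  have e1 x y : mo (e x y) <= 1 by apply: u1.
  (* Since [e] does not depend on y, a large pairing here yields a good slice by fixing x. Otherwise
     the residue keeps almost all of the pairing and the recursion continues. *)
  have [le_delta|lt_delta] := leP delta (mo (pairing (fun x y => column_part g e y * (e x y)^*) F)).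
    have : delta <= mo (\avg_x ((u x)^* * \avg_y (column_part g e y * F (x, y)))).
      apply: le_trans le_delta _; rewrite le_eqVlt; apply/orP; left; apply/eqP; congr (mo _).
      by apply: eq_Ex => x; rewrite -ExZl; apply: eq_Ex => y; rewrite /e; ring.
    move/(mo_avg_exists delta0) => [x le_x]; exists u, x; split=> //.
    rewrite ge_min; apply/orP; left; apply: le_trans le_x _.
    by rewrite (moM (u x)^*) moJ ler_piMl ?mo_ge0.
  have [|||u' [x [u'1 le_rho]]] := IHj X Y torX torY F (column_residue g e) dualF.
  - exact: column_residue_bounded.
  - apply: le_trans (column_residue_energy g e1) _.
    move: energy le_eta; rewrite -[j.+1%:R]natr1 /column_part /e.
    by move: (\avg_y _) (\avg_y _) => t t' h h'; clear - h h'; lra.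
  - rewrite pairing_residue; set q := pairing g F in le_nu *; set r := pairing _ F in lt_delta *.
    have : mo q <= mo (q - r) + mo r by rewrite -{1}(subrK r q) moD.
    move: le_nu lt_delta; rewrite -[j.+1%:R]natr1 mulrDr mulr1.
    by move=> h1 h2 h3; clear - h1 h2 h3; lra.
  pose part v := \avg_y ((\avg_x' (g x' y * v x')) * F (x, y)).
  have def_residue : \avg_y ((\avg_x' (column_residue g e x' y * u' x')) * F (x, y)) =
      part u' + - (\avg_x' ((u x')^* * u' x')) * part u.
    rewrite /part -ExZl -ExD; apply: eq_Ex => y.
    have -> : \avg_x' (column_residue g e x' y * u' x') =
        \avg_x' (g x' y * u' x') - column_part g e y * \avg_x' ((u x')^* * u' x').
      by rewrite -ExZl -ExB; apply: eq_Ex => x'; rewrite /column_residue /e; ring.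
    by rewrite -/(column_part g e y); ring.
  have : rho <= mo (part u') + mo (part u).
    rewrite def_residue in le_rho; apply: le_trans le_rho _.
    apply: le_trans (moD _ _) _; rewrite lerD2l (moM (- _)) moN ler_piMl ?mo_ge0 //.
    by apply: mo_avg_le1 => x'; apply: mo_mul_le1; rewrite ?moJ.
  have [le_u'|lt_u'] := leP (rho / 2) (mo (part u')).
    by exists u', x; split=> //; rewrite ge_min le_u' orbT.
  move=> le_sum; exists u, x; split=> //; rewrite ge_min; apply/orP; right.
  by move: le_sum lt_u'; rewrite -/(part u); clear; lra.
have [rho rho0 H] := rec J.
exists rho => // X Y torX torY F g dualF g1 le_nu; apply: (H X Y torX torY F) => //.
  by apply: le_trans J4; apply: Ex_le => // y; apply: g1.
by rewrite /delta divfK ?gt_eqF // -splitr.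
Qed.

End Slices.

Section DirectProducts.

Lemma ord_family n (P : 'I_n.+1 -> Type) (x0 : P ord0)
    (xs : forall i, P (lift ord0 i)) :
  {f : forall i, P i | f ord0 = x0 & forall i, f (lift ord0 i) = xs i}.
Proof.
exists (fun i => match unliftP ord0 i with
  | UnliftSome j e => ecast i (P i) (esym e) (xs j)
  | UnliftNone e => ecast i (P i) (esym e) x0
  end) => [|i].
  case: unliftP => [j e|e]; first by have /eqP/(_ e) := neq_lift ord0 j.
  by rewrite (eq_axiomK e).
case: unliftP => [j e|e]; last by have /eqP/(_ (esym e)) := neq_lift ord0 i.
by have eij := lift_inj e; move: e; rewrite -eij => e; rewrite (eq_axiomK e).
Qed.

Variables (n : nat) (Z : 'I_n.+1 -> finZmodType).
Local Notation G := {dffun forall i : 'I_n.+1, Z i}.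
Local Notation X := (Z ord0).
Local Notation Y := {dffun forall i : 'I_n, Z (lift ord0 i)}.

Definition dffun_cons (p : X * Y) : G :=
  [ffun i => s2val (ord_family (P := Z) p.1 (fun i => p.2 i)) i].

Lemma dffun_cons0 p : dffun_cons p ord0 = p.1.
Proof. by rewrite ffunE; case: ord_family. Qed.

Lemma dffun_consS p i : dffun_cons p (lift ord0 i) = p.2 i.
Proof. by rewrite ffunE; case: ord_family. Qed.

Lemma dffun_cons_bij : bijective dffun_cons.
Proof.
exists (fun a : G => (a ord0, [ffun i => a (lift ord0 i)] : Y)) => [[x y]|a].
  rewrite dffun_cons0; congr (_, _); apply/ffunP => i.
  by rewrite ffunE dffun_consS.
apply/ffunP => i; case: (unliftP ord0 i) => [j|] ->.
  by rewrite dffun_consS ffunE.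
by rewrite dffun_cons0.
Qed.

Lemma dffun_consD : {morph dffun_cons : p q / p + q}.
Proof.
move=> [x y] [x' y']; apply/ffunP => i.
have addE (a b : G) : (a + b) i = a i + b i by rewrite ffunE.
rewrite addE; case: (unliftP ord0 i) => [j|] ->.
  by rewrite !dffun_consS ffunE.
by rewrite !dffun_cons0.
Qed.

End DirectProducts.

Lemma dffun_torsion n (Z : 'I_n -> finZmodType) (m : 'I_n -> nat) :
    (forall i (z : Z i), z *+ m i = 0) ->
  forall a : {dffun forall i, Z i}, a *+ (\prod_i m i)%N = 0.
Proof.
move=> torZ a; apply/ffunP => i.
have -> k : (a *+ k) i = a i *+ k.
  by elim: k => [|k IHk]; rewrite ?mulr0n ?mulrS -?IHk ffunE.
by rewrite (bigD1 i) //= mulrnA torZ mul0rn ffunE.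
Qed.

Section ManyFactors.
Variable R : archiRcfType.
Local Notation C := R[i].

(** Split off the first group; the product of the others has torsion [M], coprime to [m ord0]. The
    function on that product given by [product_detects_slice] is again 1-bounded and pairs with a
    dual function, so the induction hypothesis applies to it. *)
Theorem dual_correlation s n (m : 'I_n -> nat) :
    (forall i, (0 < m i)%N) -> (forall i j, i != j -> coprime (m i) (m j)) ->
  forall nu : R, 0 < nu -> exists2 eta : R, 0 < eta &
    forall (Z : 'I_n -> finZmodType), (forall i (z : Z i), z *+ m i = 0) ->
    forall F f : {dffun forall i, Z i} -> C, isdual s F -> (forall a, mo (f a) <= 1) ->
      nu <= mo (\avg_a (f a * F a)) ->
    exists2 u : forall i, Z i -> C, forall i z, mo (u i z) <= 1 &
      eta <= mo (\avg_a (f a * \prod_i u i (a i))).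
Proof.
elim: n m => [|n IHn] m m_gt0 co nu nu0.
  exists nu => // Z _ F f dualF f1 le_nu; exists (fun i _ => 1) => [i z|]; first by rewrite mo1.
  pose a0 : {dffun forall i, Z i} := 0.
  have all_a0 a : a = a0 by apply/ffunP => -[].
  have avgE (h : {dffun forall i, Z i} -> C) : \avg_a h a = h a0.
    by rewrite -[RHS](Ex_cst a0); apply: eq_Ex => a; rewrite (all_a0 a).
  apply: le_trans le_nu _; rewrite !avgE big_ord0 mulr1 moM.
  by rewrite ler_piMr ?mo_ge0 ?(isdual_le1 _ dualF).
pose M := (\prod_i m (lift ord0 i))%N.
have M_gt0 : (0 < M)%N by apply: prodn_gt0.
have coM : coprime (m ord0) M.
  apply: (big_ind (coprime (m ord0))) => [|x y cx cy|i _].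
  - exact: coprimen1.
  - by rewrite coprimeMr cx.
  - exact: co.
have detect : product_detects R (m ord0) M s.
  by rewrite -(prednK M_gt0); apply: product_detects_all; rewrite prednK.
have [rho rho0 slice] := product_detects_slice detect nu0.
have m'_gt0 i : (0 < m (lift ord0 i))%N by [].
have co' i j : i != j -> coprime (m (lift ord0 i)) (m (lift ord0 j)).
  by move=> ij; apply: co; rewrite (inj_eq lift_inj).
have [eta eta0 IH] := IHn _ m'_gt0 co' rho rho0.
exists eta => // Z torZ F f dualF f1 le_nu.
pose q := @dffun_cons n Z.
have q_bij : bijective q := dffun_cons_bij Z.
have dualFq := isdual_bij q_bij (@dffun_consD n Z) dualF.
have [|||||u [x [u1 le_rho]]] 
  := slice (Z ord0) {dffun forall i, Z (lift ord0 i)} _ _ (F \o q)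
       (fun x y => f (q (x, y))).
- exact: torZ.
- exact: dffun_torsion (fun i => torZ (lift ord0 i)).
- exact: dualFq.
- by apply: bounded_column_bounded.
- apply: le_trans le_nu _; rewrite -(Ex_bij _ q_bij) /pairing.
  rewrite -(Ex_pair (fun x y => f (q (x, y)) * F (q (x, y)))) le_eqVlt.
  by apply/orP; left; apply/eqP; congr (mo _); apply: eq_Ex => -[].
have [||||v v1 le_eta] := IH (fun i => Z (lift ord0 i)) _ (fun y => F (q (x, y)))
    (fun y => \avg_x' (f (q (x', y)) * u x')).
- by move=> i; apply: torZ.
- exact: isdual_slice dualFq.
- by move=> y; apply: mo_avg_le1 => x'; apply: mo_mul_le1.
- exact: le_rho.
have [w w0 wS] := ord_family (P := fun i => Z i -> C) u v.
exists w => [i z|].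
  by case: (unliftP ord0 i) z => [j|] -> z; rewrite ?w0 ?wS.
apply: le_trans le_eta _; rewrite -(Ex_bij _ q_bij) le_eqVlt; apply/orP; left; apply/eqP.
congr (mo _); transitivity (\avg_x' \avg_y (f (q (x', y)) * (u x' * \prod_i v i (y i)))).
  rewrite Ex_swap; apply: eq_Ex => y; rewrite -ExZr.
  by apply: eq_Ex => x'; rewrite mulrA.
rewrite -(Ex_pair (fun x' y => f (q (x', y)) * (u x' * \prod_i v i (y i)))).
apply: eq_Ex => -[x' y] /=; congr (_ * _); rewrite big_ord_recl /q dffun_cons0 w0 /=.
by congr (_ * _); apply: eq_bigr => i _; rewrite wS dffun_consS.
Qed.

End ManyFactors.

(** * Gowers norms and cut norms *)

Section Cubes.
Variable s : nat.

Definition ffun_cons (T : Type) (p : T * {ffun 'I_s -> T}) : {ffun 'I_s.+1 -> T} :=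
  [ffun i => if unlift ord0 i is Some j then p.2 j else p.1].

Lemma ffun_cons0 T (p : T * {ffun 'I_s -> T}) : ffun_cons p ord0 = p.1.
Proof. by rewrite ffunE unlift_none. Qed.

Lemma ffun_consS T (p : T * {ffun 'I_s -> T}) i : ffun_cons p (lift ord0 i) = p.2 i.
Proof. by rewrite ffunE liftK. Qed.

Lemma ffun_cons_bij T : bijective (@ffun_cons T).
Proof.
exists (fun a : {ffun 'I_s.+1 -> T} =>
  (a ord0, [ffun i => a (lift ord0 i)] : {ffun 'I_s -> T})) => [[x y]|a].
  rewrite ffun_cons0; congr (_, _); apply/ffunP => i.
  by rewrite ffunE ffun_consS.
apply/ffunP => i; case: (unliftP ord0 i) => [j|] ->.
  by rewrite ffun_consS ffunE.
by rewrite ffun_cons0.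
Qed.

Lemma cube_vertexS (G : zmodType) (b : bool) (v : {ffun 'I_s -> bool}) (h0 : G) h :
  \sum_i ffun_cons (h0, h) i *+ ffun_cons (b, v) i = h0 *+ b + \sum_i h i *+ v i.
Proof.
rewrite big_ord_recl !ffun_cons0; congr (_ + _).
by apply: eq_bigr => i _; rewrite !ffun_consS.
Qed.

Lemma prod_cubeS (R : comNzRingType) (F : {ffun 'I_s.+1 -> bool} -> R) :
  \prod_v F v = (\prod_v F (ffun_cons (false, v))) * \prod_v F (ffun_cons (true, v)).
Proof.
rewrite (reindex (@ffun_cons bool)) /=; last exact/onW_bij/ffun_cons_bij.
by rewrite -(pair_bigA _ (fun b v => F (ffun_cons (b, v)))) /= big_bool mulrC.
Qed.

Lemma Ex_ffun_cons (K : numFieldType) (T : finType) (F : {ffun 'I_s.+1 -> T} -> K) :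
  Ex F = \avg_h0 Ex (fun h : {ffun 'I_s -> T} => F (ffun_cons (h0, h))).
Proof.
rewrite -(Ex_bij _ (ffun_cons_bij T)).
by rewrite -(Ex_pair (fun h0 h => F (ffun_cons (h0, h)))); apply: eq_Ex => -[].
Qed.

End Cubes.

Section GowersDual.
Variable R : realType.
Local Notation C := R[i].

Definition corner s : {ffun 'I_s -> bool} := [ffun=> false].

Lemma ffun_cons_corner s b v :
  (ffun_cons (b, v) == corner s.+1) = ~~ b && (v == corner s).
Proof.
apply/eqP/andP => [e|[/negbTE-> /eqP->]].
  split; first by have := ffun_cons0 (b, v); rewrite e ffunE => /= <-.
  by apply/eqP/ffunP => i; have := ffun_consS (b, v) i; rewrite e !ffunE => /= <-.
apply/ffunP => i; case: (unliftP ord0 i) => [j|] ->.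
  by rewrite ffun_consS !ffunE.
by rewrite ffun_cons0 ffunE.
Qed.

Lemma prod_cube_corner s (F : {ffun 'I_s.+1 -> bool} -> C) :
  \prod_(v | v != corner s.+1) F v =
  (\prod_(v | v != corner s) F (ffun_cons (false, v))) *
  \prod_v F (ffun_cons (true, v)).
Proof.
rewrite big_mkcond prod_cubeS; congr (_ * _).
  by rewrite [RHS]big_mkcond; apply: eq_bigr => v _; rewrite ffun_cons_corner.
by apply: eq_bigr => v _; rewrite ffun_cons_corner.
Qed.

(** Allowing a different function at each vertex closes the induction: for fixed h0 the vertices
    (false, v) and (true, v) merge into one function at v. The vertex (true, corner) is left over
    and supplies the factor f (x + h0) of [isdual]. *)
Lemma isdual_cube s (G : finZmodType) (f : {ffun 'I_s -> bool} -> G -> C) :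
    (forall v x, mo (f v x) <= 1) ->
  isdual s (fun x => Ex (fun h : {ffun 'I_s -> G} =>
    \prod_(v | v != corner s) f v (x + \sum_i h i *+ v i))).
Proof.
elim: s f => [|s IHs] f f1 /=.
  exists 1 => [|x]; first by rewrite mo1.
  rewrite -[RHS](Ex_cst ([ffun=> 0] : {ffun 'I_0 -> G})); apply: eq_Ex => h.
  by rewrite big1 // => v /eqP[]; apply/ffunP => -[].
pose D h0 x := Ex (fun h : {ffun 'I_s -> G} => \prod_(v | v != corner s)
  (f (ffun_cons (false, v)) (x + \sum_i h i *+ v i) *
   f (ffun_cons (true, v)) (x + \sum_i h i *+ v i + h0))).
exists unit, (fun _ => f (ffun_cons (true, corner s))), (fun _ => D).
split=> [_ x|_ h0|x]; first exact: f1.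
  apply: (IHs (fun v y => f (ffun_cons (false, v)) y * f (ffun_cons (true, v)) (y + h0))).
  by move=> v y; apply: mo_mul_le1.
rewrite (Ex_cst tt) Ex_ffun_cons; apply: eq_Ex => h0; rewrite -ExZl; apply: eq_Ex => h.
rewrite prod_cube_corner [X in _ * X = _](bigD1 (corner s)) //= mulrCA; congr (_ * _).
  congr (f _ _); rewrite cube_vertexS mulr1n big1 ?addr0 // => i _.
  by rewrite ffunE mulr0n.
rewrite -big_split /=; apply: eq_bigr => v _; rewrite !cube_vertexS mulr0n add0r mulr1n.
by rewrite -addrA [h0 + _]addrC.
Qed.

Lemma gowers_avg_dual s (G : finZmodType) (f : G -> C) : one_bounded f ->
  exists2 F : G -> C, isdual s F & gowers_avg s f = \avg_x (f x * F x).
Proof.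
move=> f1.
pose g (v : {ffun 'I_s -> bool}) x := iter (\sum_(i < s) v i)%N Num.conj (f x).
have g1 v x : mo (g v x) <= 1.
  by rewrite /g; elim: (\sum_(i < s) v i)%N => [|k IHk] /=; [exact: f1 | rewrite moJ].
exists (fun x => Ex (fun h : {ffun 'I_s -> G} =>
    \prod_(v | v != corner s) g v (x + \sum_i h i *+ v i))).
  exact: isdual_cube.
transitivity (\avg_x Ex (fun h : {ffun 'I_s -> G} =>
    \prod_v g v (x + \sum_i h i *+ v i))).
  exact: (Ex_pair (fun x (h : {ffun 'I_s -> G}) => \prod_v g v (x + \sum_i h i *+ v i))).
apply: eq_Ex => x; rewrite -ExZl; apply: eq_Ex => h.
rewrite (bigD1 (corner s)) //=; congr (_ * _).
rewrite /g !big1 ?addr0 // => i _; by rewrite ffunE.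
Qed.

(* [powR] sends every negative number to 1, so that [gowers_norm] is meaningful only *)
(* once [gowers_avg] is known to be nonnegative.                                      *)
Lemma gowers_avg_ge0 s (G : finZmodType) (f : G -> C) :
  0 <= complex.Re (gowers_avg s.+1 f).
Proof.
pose P (h : {ffun 'I_s -> G}) x := \prod_(v : {ffun 'I_s -> bool})
  iter (\sum_(i < s) v i)%N Num.conj (f (x + \sum_i h i *+ v i)).
suff -> : gowers_avg s.+1 f = (\avg_h (mo (\avg_x P h x) ^+ 2))%:C%C.
  by apply: Ex_ge0 => h; apply: sqr_ge0.
rewrite real_complex_avg; under [RHS]eq_Ex do rewrite sqr_mo_avgE.
rewrite [RHS]Ex_swap.
pose Q x (h : {ffun 'I_s.+1 -> G}) := \prod_(v : {ffun 'I_s.+1 -> bool})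
  iter (\sum_(i < s.+1) v i)%N Num.conj (f (x + \sum_i h i *+ v i)).
transitivity (\avg_x \avg_h Q x h); first exact: (Ex_pair Q).
apply: eq_Ex => x; rewrite Ex_ffun_cons [LHS]Ex_swap; apply: eq_Ex => h; rewrite /Q.
rewrite -[RHS](Ex_shiftl x); apply: eq_Ex => h0.
rewrite prod_cubeS /P; congr (_ * _).
  apply: eq_bigr => v _; rewrite cube_vertexS mulr0n add0r; congr (iter _ _ _).
  by rewrite big_ord_recl ffun_cons0 add0n; apply: eq_bigr => i _; rewrite ffun_consS.
rewrite rmorph_prod; apply: eq_bigr => v _; rewrite cube_vertexS mulr1n addrA -iterS.
congr (iter _ _ _).
by rewrite big_ord_recl ffun_cons0 add1n; congr _.+1; apply: eq_bigr => i _; rewrite ffun_consS.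
Qed.

Lemma gowers_norm_gt s (G : finZmodType) (f : G -> C) (delta : R) : 0 < delta ->
  delta < gowers_norm s.+1 f -> delta ^+ (2 ^ s.+1) <= mo (gowers_avg s.+1 f).
Proof.
move=> delta0 /ltW; set z := gowers_avg _ _; rewrite /gowers_norm -/z => le_delta.
have z0 : 0 <= complex.Re z by apply: gowers_avg_ge0.
have le_Re : complex.Re z <= mo z.
  rewrite -lecR moE; apply: le_trans (normc_ge_Re z).
  by rewrite lecR ler_norm.
apply: le_trans le_Re.
have N0 : (2 ^ s.+1)%N%:R != 0 :> R by rewrite pnatr_eq0 expn_eq0.
have -> : complex.Re z = (complex.Re z `^ ((2 ^ s.+1)%N%:R)^-1) ^+ (2 ^ s.+1).
  by rewrite -powR_mulrn ?powR_ge0 // -powRrM mulVf // powRr1.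
by rewrite lerXn2r // nnegrE ?powR_ge0 // ltW.
Qed.

End GowersDual.

Section CutNorm.
Variable R : realType.
Local Notation C := R[i].

Lemma big_card1 n (F : {set 'I_n} -> C) :
  \prod_(B : {set 'I_n} | #|B| == 1%N) F B = \prod_i F [set i].
Proof.
rewrite -(big_imset F (h := set1) (A := predT)) /=; last by move=> i j _ _; apply: set1_inj.
apply: eq_bigl => B; apply/cards1P/imsetP => [[i ->]|[i _ ->]]; first by exists i.
by exists i.
Qed.

Lemma mo_prod_le1 (I : finType) (P : pred I) (z : I -> C) :
  (forall i, P i -> mo (z i) <= 1) -> mo (\prod_(i | P i) z i) <= 1.
Proof.
move=> z1; apply: (big_ind (fun w => mo w <= 1)) => //; first by rewrite mo1.
by move=> *; apply: mo_mul_le1.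
Qed.

Lemma cut_norm_ge n (A : 'I_n -> finType) (f : {dffun forall i, A i} -> C)
    (u : forall i, A i -> C) :
    one_bounded f -> (forall i z, mo (u i z) <= 1) ->
  mo (\avg_a (f a * \prod_i u i (a i))) <= cut_norm 1 f.
Proof.
move=> f1 u1; apply: ub_le_sup.
  exists 1 => _ [v [v1 ->]]; apply: mo_avg_le1 => a; apply: mo_mul_le1; first exact: f1.
  by apply: mo_prod_le1 => B /eqP B1; rewrite moJ; apply: v1.
(* On a singleton [[pick ...]] returns its only index; the conjugate cancels the one in
   [cut_norm]. *)
pose U (B : {set 'I_n}) (z : subprod A B) : C :=
  if [pick j : {i : 'I_n | i \in B}] is Some j then (u (val j) (z j))^* else 1.
exists U; split=> [B _ z|].
  rewrite -[modulus _]/(mo _) /U; case: pickP => [j _|_]; last by rewrite mo1.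
  exact: mo_conj_le1.
congr (mo _); apply: eq_Ex => a; congr (_ * _).
rewrite big_card1; apply: eq_bigr => i _; rewrite /U.
case: pickP => [[j /= jP] _|/(_ (exist _ i (set11 i)))//].
by rewrite conjCK ffunE /=; move/set1P: jP => ->.
Qed.

End CutNorm.

Theorem corollary1p8 (R : realType) (k n : nat) (m : 'I_n -> nat)
    (hn : (2 <= n)%N)
    (m_gt0 : forall i, (0 < m i)%N)
    (m_coprime : forall i j, i != j -> coprime (m i) (m j))
    (delta : R) (delta_gt0 : 0 < delta) :
  exists epsilon : R, 0 < epsilon /\
    forall (Z : 'I_n -> finZmodType)
      (hZ : forall i, has_torsion (Z i) (m i))
      (f : {dffun forall i : 'I_n, Z i} -> R[i]),
      one_bounded f ->
      delta < gowers_norm k.+1 f ->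
      epsilon < cut_norm 1 f.
Proof.
have nu0 : 0 < delta ^+ (2 ^ k.+1) by apply: exprn_gt0.
have [eta eta0 correlate] := dual_correlation k.+1 m_gt0 m_coprime nu0.
(* Halving turns the bound [eta <= cut_norm 1 f] into a strict one. *)
exists (eta / 2); split=> [|Z torZ f f1 big]; first exact: divr_gt0.
have [F dualF avgE] := gowers_avg_dual k.+1 f1.
have le_nu : delta ^+ (2 ^ k.+1) <= mo (\avg_a (f a * F a)).
  by rewrite -avgE; apply: gowers_norm_gt.
have [u u1 le_eta] := correlate Z torZ F f dualF f1 le_nu.
apply: (@lt_le_trans _ _ eta); first by rewrite ltr_pdivrMr // ltr_pMr // ltr1n.
exact: le_trans le_eta (cut_norm_ge f1 u1).
Qed.
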